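(* Let $\Omega\subset\mathbb R^n$, $n\geqslant 2$, be a bounded domain with $\partial\Omega\in C^{4+\alpha}$, $0<\alpha<1$, and assume that the Gauss curvature of $\partial\Omega$ is positive. Let $w$ be the nontrivial solution, $w\leqslant 0$, of the Dirichlet problem $$\det w_{xx}-\Delta w=0\ \text{ in }\Omega,\qquad w|_{\partial\Omega}=0 .$$ Then for every $u\in W^{1,2}_0(\Omega)$ $$\frac{n-1}{\int_\Omega|w_x|^2dx}\left(\int_\Omega u\,\Delta w\,dx\right)^2+\int_\Omega|u_x|^2dx\leqslant\int_\Omega u_iu_j\frac{\partial}{\partial w_{ij}}(\det w_{xx})\,dx .$$
   Context: $u_x$ is the gradient, $u_i=\partial u/\partial x^i$, and $w_{xx}=(w_{ij})$ is the Hesse matrix of $w$. Repeated indices $i,j$ are summed from $1$ to $n$. $\frac{\partial}{\partial w_{ij}}(\det w_{xx})$ is the derivative of the determinant with respect to the $(i,j)$ entry, all $n^2$ entries being regarded as independent variables (i.e. the $(i,j)$ cofactor of $w_{xx}$). $W^{1,2}_0(\Omega)$ is the Sobolev space of functions with square integrable first derivatives and zero boundary values. The Gauss curvature of $\partial\Omega$ is the product of its principal curvatures, with sign convention such that the principal curvatures of a sphere bounding a ball are positive. Under the stated hypotheses on $\Omega$ the Dirichlet problem is known to have exactly one nontrivial solution $w\in C^2$ with $w\leqslant0$; it belongs to $C^{4+\alpha}(\bar\Omega)$, and $w$ denotes this solution. *)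

(* Defs.v *)
From HB Require Import structures.
From mathcomp Require Import all_boot all_order all_algebra.
From mathcomp Require Import all_classical all_reals all_analysis.

Set Implicit Arguments.
Unset Strict Implicit.
Unset Printing Implicit Defensive.

Import Order.TTheory GRing.Theory Num.Theory.
Import numFieldNormedType.Exports.

Local Open Scope classical_set_scope.
Local Open Scope ring_scope.

Section measurable_rV.
Context {R : realType} (n : nat).

Let coord (i : 'I_n) (x : 'rV[R]_n) : R := x ord0 i.

Let rV_set0 : g_sigma_preimage coord set0.
Proof. exact: sigma_algebra0. Qed.

Let rV_setC A : g_sigma_preimage coord A -> g_sigma_preimage coord (~` A).
Proof. exact: sigma_algebraC. Qed.

Let rV_bigcup (F : _^nat) : (forall i, g_sigma_preimage coord (F i)) ->
  g_sigma_preimage coord (\bigcup_i (F i)).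
Proof. exact: sigma_algebra_bigcup. Qed.

HB.instance Definition _ := @isMeasurable.Build default_measure_display
  'rV[R]_n (g_sigma_preimage coord) rV_set0 rV_setC rV_bigcup.

Lemma measurable_coord_rV (i : 'I_n) :
  measurable_fun [set: 'rV[R]_n] (fun x => x ord0 i).
Proof.
move=> _ Y mY; rewrite setTI; apply: sub_sigma_algebra => /=.
rewrite -bigcup_seq/=; exists i => /=; first by rewrite mem_index_enum.
by exists Y => //; rewrite setTI.
Qed.

Lemma measurable_fun_rV d (T : measurableType d) (f : T -> 'rV[R]_n) :
  (forall i, measurable_fun [set: T] (fun t => f t ord0 i)) ->
  measurable_fun [set: T] f.
Proof.
move=> mf _ A mA; rewrite setTI; move: A mA.
apply: smallest_sub.
  split => [|A|F].
  - by rewrite preimage_set0; exact: measurable0.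
  - by move=> mA; rewrite setTD preimage_setC; exact: measurableC.
  - by move=> mF; rewrite preimage_bigcup; exact: bigcup_measurable.
rewrite -bigcup_seq => A [i _ [B mB <-]] /=.
by rewrite setTI; have := mf i measurableT B mB; rewrite setTI.
Qed.

End measurable_rV.

Section lebesgue_rV.
Context {R : realType}.

Definition cons_rV n (p : measurableTypeR R * 'rV[R]_n) : 'rV[R]_n.+1 :=
  \row_(i < n.+1) oapp (fun j => p.2 ord0 j) p.1 (unlift ord0 i).

Lemma measurable_cons_rV n : measurable_fun [set: _] (@cons_rV n).
Proof.
apply: measurable_fun_rV => i.
case: (unliftP ord0 i) => [j ->|->].
- rewrite (_ : (fun _ => _) = (fun x : 'rV[R]_n => x ord0 j) \o snd); last first.
    by apply/funext => p; rewrite mxE liftK.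
  by apply: measurableT_comp => //; exact: measurable_coord_rV.
- rewrite (_ : (fun _ => _) = fst); first exact: measurable_fst.
  by apply/funext => p; rewrite mxE unlift_none.
Qed.

Definition uncons_rV n (x : 'rV[R]_n.+1) : measurableTypeR R * 'rV[R]_n :=
  (x ord0 ord0, \row_j x ord0 (lift ord0 j)).

Lemma cons_rVK n : cancel (@cons_rV n) (@uncons_rV n).
Proof.
move=> [a y]; rewrite /uncons_rV; congr pair.
- by rewrite mxE unlift_none.
- by apply/rowP => j; rewrite !mxE liftK.
Qed.

Lemma measurable_uncons_rV n : measurable_fun [set: _] (@uncons_rV n).
Proof.
apply/measurable_fun_pair.
- exact: measurable_coord_rV.
- apply: measurable_fun_rV => i.
  under eq_fun do rewrite mxE.
  exact: measurable_coord_rV.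
Qed.

Section cons_measure.
Local Open Scope ereal_scope.
Context n (mu : {sigma_finite_measure set 'rV[R]_n -> \bar R}).

Definition cons_measure : set 'rV[R]_n.+1 -> \bar R :=
  pushforward (@lebesgue_measure R \x mu) (@cons_rV n).

Let cons_measure0 : cons_measure set0 = 0.
Proof. by rewrite /cons_measure /pushforward preimage_set0 measure0. Qed.

Let cons_measure_ge0 A : 0 <= cons_measure A.
Proof. by rewrite /cons_measure /pushforward measure_ge0. Qed.

Let cons_measure_sigma_additive : semi_sigma_additive cons_measure.
Proof.
have mc A : measurable A -> measurable (@cons_rV n @^-1` A).
  by move=> mA; rewrite -[X in measurable X]setTI; exact: measurable_cons_rV.
move=> F mF tF mUF; rewrite /cons_measure /pushforward preimage_bigcup.
apply: measure_semi_sigma_additive.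
- by move=> k; exact: mc.
- apply/trivIsetP => /= i j _ _ ij; rewrite -preimage_setI.
  by move/trivIsetP : tF => /(_ _ _ _ _ ij) ->//; rewrite preimage_set0.
- by rewrite -preimage_bigcup; exact: mc.
Qed.

HB.instance Definition _ := isMeasure.Build _ _ _ cons_measure
  cons_measure0 cons_measure_ge0 cons_measure_sigma_additive.

Let cons_measure_sigma_finite : sigma_finite setT cons_measure.
Proof.
have /sigma_finiteP[F [TF ndF Foo]] := sigma_finiteT (@lebesgue_measure R).
have /sigma_finiteP[G [TG ndG Goo]] := sigma_finiteT mu.
exists (fun k => @uncons_rV n @^-1` (F k `*` G k)).
  rewrite -preimage_bigcup (_ : \bigcup_k _ = setT) ?preimage_setT//.
  apply/seteqP; split => // -[x y] _.
  have [k _ Fkx] : (\bigcup_k F k) x by rewrite -TF.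
  have [l _ Gly] : (\bigcup_k G k) y by rewrite -TG.
  exists (maxn k l) => //; split => /=.
  - by move: x Fkx; exact/subsetPset/ndF/leq_maxl.
  - by move: y Gly; exact/subsetPset/ndG/leq_maxr.
move=> k; have [mFk Fkoo] := Foo k; have [mGk Gkoo] := Goo k.
have mFG : measurable (F k `*` G k) by exact: measurableX.
split; first by rewrite -[X in measurable X]setTI; exact: measurable_uncons_rV.
rewrite /cons_measure /pushforward -comp_preimage.
rewrite (_ : _ \o _ = id) ?preimage_id; last first.
  by apply/funext => p; exact: cons_rVK.
by rewrite product_measure1E// lte_mul_pinfty// ge0_fin_numE.
Qed.

HB.instance Definition _ := Measure_isSigmaFinite.Build _ _ _ cons_measure
  cons_measure_sigma_finite.

End cons_measure.

(* Lebesgue measure on the Borel sets of R^n, as the iterated product of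
   the Lebesgue measure of R; cons_rV (a, y) is the vector y with a prepended. *)
Fixpoint lebesgue_rV n : {sigma_finite_measure set 'rV[R]_n -> \bar R} :=
  if n is m.+1 then cons_measure (lebesgue_rV m) else \d_(0 : 'rV[R]_0).

Lemma lebesgue_rV_box n (A : 'I_n -> set R) : (forall i, measurable (A i)) ->
  lebesgue_rV n [set x | forall i, A i (x ord0 i)] =
  (\prod_(i < n) lebesgue_measure (A i))%E.
Proof.
elim: n A => [A _|n ih A mA].
  by rewrite big_ord0 /= diracE mem_set// => -[].
pose B := [set y : 'rV[R]_n | forall j, A (lift ord0 j) (y ord0 j)].
have mB : measurable B.
  rewrite (_ : B = \bigcap_(j in [set: 'I_n])
      ((fun y : 'rV[R]_n => y ord0 j) @^-1` A (lift ord0 j))); last first.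
    by apply/seteqP; split => y /= h j; [move=> _; exact: h|exact: h].
  apply: fin_bigcap_measurable => // j _.
  rewrite -[X in measurable X]setTI.
  exact: measurable_coord_rV.
rewrite big_ord_recl -ih// -[LHS]/(cons_measure (lebesgue_rV n) _).
rewrite /cons_measure /pushforward -product_measure1E//; last exact: mA.
congr (_ _); apply/seteqP; split => [[a y]/= h|[a y]/= [Aa By] i].
- split => [|j]/=.
  + by have := h ord0; rewrite mxE unlift_none.
  + by have := h (lift ord0 j); rewrite mxE liftK.
- by rewrite mxE; case: (unliftP ord0 i) => [j ->|->]//=; exact: By.
Qed.

End lebesgue_rV.

Section calculus.
Context {R : realType} (n : nat).
Implicit Types (Om : set 'rV[R]_n) (f : 'rV[R]_n -> R).

Definition partial (i : 'I_n) f : 'rV[R]_n -> R :=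
  fun x => 'D_(delta_mx ord0 i) f x.

Definition iter_partial (s : seq 'I_n) f : 'rV[R]_n -> R := foldr partial f s.

Definition hessian f (x : 'rV[R]_n) : 'M[R]_n :=
  \matrix_(i, j) partial i (partial j f) x.

Definition laplacian f (x : 'rV[R]_n) : R := \sum_i partial i (partial i f) x.

Definition bdry Om : set 'rV[R]_n := closure Om `\` interior Om.

Definition is_domain Om := [/\ open Om, connected Om & Om !=set0].

Definition Ck (k : nat) Om f :=
  forall s x, (size s <= k)%N -> Om x ->
    {for x, continuous (iter_partial s f)} /\
    ((size s < k)%N ->
      forall i, derivable (iter_partial s f) x (delta_mx ord0 i)).

(* C^{k+a} of the closure of Om (k-th derivatives are uniformly a-Hoelder).
   `| _ | is the sup norm of 'rV[R]_n; being equivalent to the Euclidean norm,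
   it defines the same Hoelder class. *)
Definition Ckh_closure (k : nat) (a : R) Om f :=
  [/\ Ck k Om f,
      {within closure Om, continuous f},
      forall s, (size s <= k)%N -> exists2 g : 'rV[R]_n -> R,
        {within closure Om, continuous g} &
        forall x, Om x -> g x = iter_partial s f x &
      forall s, size s = k -> exists C : R, forall x y, Om x -> Om y ->
        `|iter_partial s f x - iter_partial s f y| <= C * `|x - y| `^ a].

Definition test_function Om (phi : 'rV[R]_n -> R) :=
  let supp := closure [set x | phi x != 0] in
  [/\ forall k, Ck k setT phi, compact supp & supp `<=` Om].

End calculus.

Section hypersurface.
Context {R : realType}.

Section graph_curvature.
Context (m : nat) (psi : 'rV[R]_m -> R) (y : 'rV[R]_m).

(* Fundamental forms at the point (y, psi y) of the hypersurface t = psi y,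
   parametrized by y, with respect to the unit normal
   (- psi_y, 1) / sqrt (1 + |psi_y|^2), which points into {t > psi y}. *)
Definition first_form : 'M[R]_m :=
  \matrix_(i, j) ((i == j)%:R + partial i psi y * partial j psi y).

Definition second_form : 'M[R]_m :=
  (Num.sqrt (1 + \sum_i partial i psi y ^+ 2))^-1 *: hessian psi y.

Definition shape_operator : 'M[R]_m := invmx first_form *m second_form.

(* The eigenvalues of the shape operator, with multiplicity. *)
Definition principal_curvatures (k : 'I_m -> R) :=
  char_poly shape_operator = \prod_i ('X - (k i)%:P).

Definition gauss_curvature (K : R) :=
  exists2 k, principal_curvatures k & K = \prod_i k i.

End graph_curvature.

(* In the Cartesian coordinates (y, t) centred at p whose axes are the rows of
   the orthonormal frame (E, nu), Om is near p the set {t > psi y}, where psi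
   is of class C^{k+a}.  The normal used above is then the inner one, so that
   the principal curvatures of a sphere bounding a ball are positive. *)
Definition boundary_chart n (k : nat) (a : R) (Om : set 'rV[R]_n)
    (p : 'rV[R]_n) (E : 'M[R]_(n.-1, n)) (nu : 'rV[R]_n)
    (psi : 'rV[R]_n.-1 -> R) :=
  [/\ E *m E^T = 1%:M, nu *m nu^T = 1%:M, E *m nu^T = 0 &
      exists r h : R, [/\ 0 < r, 0 < h,
        Ckh_closure k a (ball (0 : 'rV[R]_n.-1) r) psi &
        forall y t, ball (0 : 'rV[R]_n.-1) r y -> `|t| < h ->
          (Om (p + y *m E + t *: nu) <-> psi y < t)]].

Definition Ckh_boundary n (k : nat) (a : R) (Om : set 'rV[R]_n) :=
  forall p, bdry Om p -> exists E nu psi, boundary_chart k a Om p E nu psi.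

Definition positive_gauss_curvature n (k : nat) (a : R)
    (Om : set 'rV[R]_n) :=
  forall p E nu psi, bdry Om p -> boundary_chart k a Om p E nu psi ->
    exists2 K, gauss_curvature psi 0 K & 0 < K.

End hypersurface.

Section sobolev.
Context {R : realType} (n : nat).
Implicit Types (Om : set 'rV[R]_n) (u g : 'rV[R]_n -> R)
  (Du : 'I_n -> 'rV[R]_n -> R).

Local Notation mu := (@lebesgue_rV R n).

Definition square_integrable Om u :=
  measurable_fun Om u /\ mu.-integrable Om (fun x => (u x ^+ 2)%:E).

Definition weak_partial Om (i : 'I_n) u g :=
  forall phi, test_function Om phi ->
    \int[mu]_(x in Om) (u x * partial i phi x) =
    - \int[mu]_(x in Om) (g x * phi x).

(* u belongs to W^{1,2}(Om) and its weak gradient is Du. *)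
Definition W12 Om u Du :=
  square_integrable Om u /\
  forall i, square_integrable Om (Du i) /\ weak_partial Om i u (Du i).

(* W^{1,2}_0(Om): the closure of C_c^\infty(Om) in the norm of W^{1,2}(Om). *)
Definition W12_0 Om u Du :=
  W12 Om u Du /\
  exists2 phi : nat -> 'rV[R]_n -> R, (forall k, test_function Om (phi k)) &
    (\int[mu]_(x in Om) ((phi k x - u x) ^+ 2 +
       \sum_i (partial i (phi k) x - Du i x) ^+ 2)%:E)%E @[k --> \oo] --> 0%E.

End sobolev.

(* dF/dw_ij at W for a function F of n^2 independent entries. *)
Definition partial_entry (R : realType) n (F : 'M[R]_n -> R)
    (i j : 'I_n) (W : 'M[R]_n) : R := 'D_(delta_mx i j) F W.

(* Main.v *)
Require Import Defs.
From HB Require Import structures.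
From mathcomp Require Import all_boot all_order all_algebra.
From mathcomp Require Import all_classical all_reals all_analysis.
From mathcomp Require Import perm measurable_realfun ring lra.

Set Implicit Arguments.
Unset Strict Implicit.
Unset Printing Implicit Defensive.

Import Order.TTheory GRing.Theory Num.Theory.
Import numFieldNormedType.Exports.

Local Open Scope classical_set_scope.
Local Open Scope ring_scope.

(** Write [W] for the Hessian of [w], [A] for its cofactor matrix and
    [Q(u, v)] for the integral of [(A - 1) Du . Dv]; the theorem bounds
    [Q(u, u)] from below.

    The linearization of [det W - tr W] at [w] is the operator with matrix
    [A - 1].  It is in divergence form, because the columns of the cofactor
    matrix of a Hessian are divergence free ([cofactor_hessian_div0]), and it
    maps [w] to [(n - 1) Lap w], because [det W = Lap w].  Integration by
    parts therefore gives [Q(w, u) = - (n - 1) int u Lap w] for [u] in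
    [W^{1,2}_0] ([W12_0_functional_eq0]) and [Q(w, w) = (n - 1) int |Dw|^2]
    ([integral_divfree_grad_eq0]).  So the inequality to be proved is
    [Q(w, u)^2 / Q(w, w) <= Q(u, u)], the Cauchy--Schwarz inequality for [Q],
    and it suffices that [A - 1] is nonnegative at every point.

    If [W] is positive with eigenvalues [l_i], those of [A] are
    [det W / l_i = tr W / l_i >= 1] ([psd_cofactor_ge1]).  To see that [W] is
    positive everywhere ([hessian_psd_on]), note that for a nonnegative [W] the
    equation [det W = tr W] says that [W] is either [0] or positive definite
    with a trace bounded below by a constant ([psd_tr_isolated]).  The set
    where [W] is positive is thus both open and closed in the domain.  It is
    not empty: [w - c |x - x1|^2] has an interior minimum if [w x1 < 0] and
    [c > 0] is small, since [w] vanishes on the boundary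
    ([exists_convex_point]). *)

(** * Quadratic forms and cofactor matrices *)

Section quadratic_forms.
Context {R : realFieldType} (n : nat).
Implicit Types (M : 'M[R]_n) (u v : 'rV[R]_n).

Definition bil M u v : R := (u *m M *m v^T) ord0 ord0.

Definition psd M := M^T = M /\ forall v, 0 <= bil M v v.

Lemma bilE M u v : bil M u v = \sum_i \sum_j u ord0 i * v ord0 j * M i j.
Proof.
rewrite /bil mxE exchange_big /=; apply: eq_bigr => j _.
rewrite !mxE big_distrl /=; apply: eq_bigr => i _.
by rewrite mulrAC.
Qed.

Lemma bilB M M' u v : bil (M - M') u v = bil M u v - bil M' u v.
Proof. by rewrite /bil mulmxBr mulmxBl mxE [X in _ + X]mxE. Qed.

Lemma bil_delta M i j : bil M (delta_mx ord0 i) (delta_mx ord0 j) = M i j.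
Proof. by rewrite /bil -rowE trmx_delta -colE !mxE. Qed.

Lemma bil_sym M u v : M^T = M -> bil M u v = bil M v u.
Proof.
move=> sM; rewrite /bil -[in RHS]sM -[in RHS](trmxK v) -!trmx_mul mulmxA.
by rewrite [RHS]mxE.
Qed.

Lemma bil_deltar M u i : bil M u (delta_mx ord0 i) = (u *m M) ord0 i.
Proof. by rewrite /bil trmx_delta -colE !mxE. Qed.

Lemma bilDZ M u v (s : R) : M^T = M ->
  bil M (u + s *: v) (u + s *: v) =
  bil M u u + 2 * s * bil M u v + s ^+ 2 * bil M v v.
Proof.
move=> sM; have := bil_sym u v sM; rewrite /bil => uv.
have eD (A B : 'M[R]_1) : (A + B) ord0 ord0 = A ord0 ord0 + B ord0 ord0.
  by rewrite mxE.
have eZ k (A : 'M[R]_1) : (k *: A) ord0 ord0 = k * A ord0 ord0 by rewrite mxE.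
rewrite linearD /= linearZ /= !mulmxDl !mulmxDr -!scalemxAl -!scalemxAr.
rewrite !(eD, eZ) -uv.
by ring.
Qed.

Lemma psd_CauchySchwarz M u v : psd M ->
  bil M u v ^+ 2 <= bil M u u * bil M v v.
Proof.
move=> [sM pM].
have H s : 0 <= bil M u u + 2 * s * bil M u v + s ^+ 2 * bil M v v.
  by rewrite -bilDZ.
have v0 := pM v; move: H v0.
move: (bil M u u) (bil M u v) (bil M v v) => a b c H.
rewrite le_eqVlt => /orP[/eqP c0|c0].
  rewrite -c0 mulr0; have [->|b0] := eqVneq b 0; first by rewrite expr0n.
  have := H (- (a + 1) / (2 * b)); rewrite -c0 mulr0 addr0.
  rewrite (_ : 2 * _ * b = - (a + 1)); first by lra.
  by field.
have := H (- b / c).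
rewrite (_ : a + _ + _ = (a * c - b ^+ 2) / c); last by field; rewrite gt_eqF.
by rewrite pmulr_lge0 ?invr_gt0// subr_ge0.
Qed.

Lemma bil1 v : bil 1%:M v v = \sum_i v ord0 i ^+ 2.
Proof. by rewrite /bil mulmx1 mxE; apply: eq_bigr => i _; rewrite mxE. Qed.

Lemma psd1 : psd 1%:M.
Proof.
split; first by rewrite trmx1.
by move=> v; rewrite bil1 sumr_ge0// => i _; rewrite sqr_ge0.
Qed.

Lemma psd_diag_ge0 M i : psd M -> 0 <= M i i.
Proof. by move=> [_ pM]; rewrite -bil_delta. Qed.

(** Cauchy--Schwarz for the form of [M] against each basis vector, summed. *)
Lemma psd_sqnorm_mulmx_le M v : psd M ->
  \sum_i (v *m M) ord0 i ^+ 2 <= \tr M * bil M v v.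
Proof.
move=> pM; rewrite /mxtrace big_distrl /=; apply: ler_sum => i _.
by rewrite -bil_deltar -(bil_delta M i i) mulrC psd_CauchySchwarz.
Qed.

Lemma psd_entry_le_tr M i j : psd M -> `|M i j| <= \tr M.
Proof.
move=> pM; have d0 k := psd_diag_ge0 k pM.
have trk k : M k k <= \tr M.
  by rewrite /mxtrace (bigD1 k)//= lerDl sumr_ge0.
have tr0 : 0 <= \tr M by apply: le_trans (trk i).
rewrite -(ler_sqr (x := `|_|)) ?nnegrE// real_normK ?num_real//.
have := psd_CauchySchwarz (delta_mx ord0 i) (delta_mx ord0 j) pM.
rewrite !bil_delta => /le_trans; apply.
by rewrite expr2 ler_pM.
Qed.

Lemma psd_det_le M : psd M -> \det M <= n`!%:R * \tr M ^+ n.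
Proof.
move=> pM; apply: (le_trans (ler_norm _)).
apply: (le_trans (ler_norm_sum _ _ _)).
rewrite (_ : n`! = #|{: {perm 'I_n}}|); last by rewrite card_Sn.
rewrite -sum1_card natr_sum big_distrl /=.
apply: ler_sum => s _; rewrite mul1r normrM normrX normrN1 expr1n mul1r.
rewrite normr_prod -[X in _ ^+ X]card_ord -prodr_const.
by apply: ler_prod => i _; rewrite normr_ge0 psd_entry_le_tr.
Qed.

(** By homogeneity the equation [det = tr] isolates [0] among the nonnegative
    matrices: the left side has degree [n >= 2], the right one degree 1. *)
Lemma psd_tr_isolated M : (2 <= n)%N -> psd M -> \det M = \tr M ->
  0 < \tr M -> n`!%:R^-1 <= \tr M.
Proof.
move=> n2 pM dt tr0; have := psd_det_le pM; rewrite dt => H.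
have f0 : 0 < (n`!%:R : R) by rewrite ltr0n fact_gt0.
rewrite leNgt; apply/negP => trlt.
have f1 : 1 <= (n`!%:R : R) by rewrite ler1n fact_gt0.
have tr1 : \tr M <= 1.
  by apply: (le_trans (ltW trlt)); rewrite invf_le1.
have : \tr M ^+ n <= \tr M ^+ 2 by rewrite ler_wiXn2l// ltW.
move=> H2; move: H; apply/negP; rewrite -ltNge.
apply: (@le_lt_trans _ _ (n`!%:R * \tr M ^+ 2)).
  by rewrite ler_pM2l.
rewrite expr2 mulrA -[ltRHS]mul1r ltr_pM2r//.
by rewrite mulrC -ltr_pdivlMr// mul1r.
Qed.

Definition cofactor_mx M : 'M[R]_n := \matrix_(i, j) cofactor M i j.

Lemma cofactor_mxE M : M^T = M -> cofactor_mx M = \adj M.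
Proof.
by move=> sM; apply/matrixP => i j; rewrite !mxE -[in LHS]sM cofactor_tr.
Qed.

Lemma cofactor_mx_sym M : M^T = M -> (cofactor_mx M)^T = cofactor_mx M.
Proof. by move=> sM; apply/matrixP => i j; rewrite !mxE -cofactor_tr sM. Qed.

(** If [M] has eigenvalues [l_i > 0], those of its cofactor matrix are
    [det M / l_i = tr M / l_i >= 1].  Diagonalization is avoided by writing
    a vector as [y M], on which the cofactor matrix takes the value
    [tr M * (y M y)]. *)
Lemma psd_cofactor_ge1 M : psd M -> \det M = \tr M -> 0 < \tr M ->
  psd (cofactor_mx M - 1%:M).
Proof.
move=> pM dt tr0; have sM := pM.1; split.
  by rewrite linearB /= trmx1 cofactor_mx_sym.
move=> v; have uM : M \in unitmx by rewrite unitmxE dt unitfE gt_eqF.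
rewrite bilB subr_ge0 bil1.
have [y ->] : exists y, v = y *m M by exists (v *m invmx M); rewrite mulmxKV.
apply: (le_trans (psd_sqnorm_mulmx_le y pM)).
rewrite cofactor_mxE// /bil -!mulmxA (mulmxA M (\adj M)) mul_mx_adj.
rewrite trmx_mul sM mul_scalar_mx -scalemxAr dt.
by rewrite [leRHS]mxE mulmxA.
Qed.

Lemma sqnorm_mulmx_le (B : 'M[R]_n) v :
  \sum_i (v *m B) ord0 i ^+ 2 <=
  (\sum_i \sum_j B j i ^+ 2) * \sum_i v ord0 i ^+ 2.
Proof.
rewrite big_distrl /=; apply: ler_sum => i _.
have := psd_CauchySchwarz v (col i B)^T psd1; rewrite !bil1 /bil mulmx1 trmxK.
rewrite (_ : (v *m col i B) _ _ = (v *m B) ord0 i); last first.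
  by rewrite !mxE; apply: eq_bigr => j _; rewrite mxE.
rewrite mulrC => /le_trans; apply.
by rewrite le_eqVlt; apply/orP; left; apply/eqP; congr (_ * _);
  apply: eq_bigr => j _; rewrite !mxE.
Qed.

(** Definiteness with a constant, in the form that survives a perturbation of
    the entries ([coercive_perturb]). *)
Lemma psd_unit_coercive M : psd M -> M \in unitmx ->
  exists2 c : R, 0 < c & forall v, c * \sum_i v ord0 i ^+ 2 <= bil M v v.
Proof.
move=> pM uM; set K := \sum_i \sum_j (invmx M) j i ^+ 2.
have K0 : 0 <= K.
  by rewrite sumr_ge0// => i _; rewrite sumr_ge0// => j _; rewrite sqr_ge0.
have tr0 : 0 <= \tr M.
  by rewrite sumr_ge0// => i _; exact: psd_diag_ge0.
have c0 : 0 < K * \tr M + 1 by rewrite ltr_wpDl// mulr_ge0.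
exists (K * \tr M + 1)^-1; first by rewrite invr_gt0.
move=> v; rewrite mulrC ler_pdivrMr// mulrDr mulr1.
apply: (@le_trans _ _ (bil M v v * (K * \tr M))); last by rewrite lerDl pM.2.
have := sqnorm_mulmx_le (invmx M) (v *m M); rewrite mulmxK// -/K => /le_trans.
apply; rewrite [leRHS]mulrCA ler_wpM2l// [leRHS]mulrC.
exact: psd_sqnorm_mulmx_le.
Qed.

Lemma coercive_perturb M M' (c : R) : M'^T = M' ->
  (forall v, c * \sum_i v ord0 i ^+ 2 <= bil M v v) ->
  (forall i j, `|M' i j - M i j| <= c / n%:R) -> psd M'.
Proof.
move=> sM' cM dM; split => // v.
have [n0|n0] := posnP n.
  by rewrite bilE big1// => i; exfalso; case: i => i; rewrite n0.
have -> : bil M' v v = bil M v v + bil (M' - M) v v.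
  by rewrite bilB addrCA subrr addr0.
have nR : (n%:R : R) != 0 by rewrite pnatr_eq0 -lt0n.
apply: (@le_trans _ _ (c * \sum_i v ord0 i ^+ 2 - c * \sum_i v ord0 i ^+ 2)).
  by rewrite subrr.
apply: lerD => //; rewrite lerNl; apply: (le_trans (ler_norm _)).
rewrite normrN bilE; apply: (le_trans (ler_norm_sum _ _ _)).
apply: (@le_trans _ _ (\sum_i \sum_j
    ((v ord0 i ^+ 2 + v ord0 j ^+ 2) / 2) * (c / n%:R))).
  apply: ler_sum => i _; apply: (le_trans (ler_norm_sum _ _ _)).
  apply: ler_sum => j _; rewrite normrM ler_pM//; last by rewrite !mxE.
  rewrite ler_norml; apply/andP; split.
    have := sqr_ge0 (v ord0 i + v ord0 j); lra.
  have := sqr_ge0 (v ord0 i - v ord0 j); lra.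
under eq_bigr do rewrite -mulr_suml -mulr_suml big_split /= sumr_const card_ord.
rewrite -mulr_suml -mulr_suml big_split /= sumr_const card_ord sumrMnl.
rewrite le_eqVlt; apply/orP; left; apply/eqP.
by set S := \sum_i _; rewrite -(mulr_natr S); field.
Qed.

End quadratic_forms.

(** [T i k l] stands for the [i]-th derivative of [M k l], so that the inner
    sums are the derivatives of the cofactors.  In the expansion over
    permutations the term of [(i, k, s)] cancels that of
    [(k, i, tperm i k * s)]: the third derivative and the remaining product
    agree, the signatures are opposite. *)
Lemma cofactor_deriv_sum0 (R : numDomainType) n (M : 'M[R]_n)
    (T : 'I_n -> 'I_n -> 'I_n -> R) (j : 'I_n) :
  (forall i k l, T i k l = T k i l) ->
  \sum_i \sum_(s : {perm 'I_n} | s i == j) (-1) ^+ s *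
    \sum_(k | i != k) T i k (s k) *
      \prod_(m | (i != m) && (m != k)) M m (s m) = 0.
Proof.
move=> Tsym.
pose F i k (s : {perm 'I_n}) : R := (-1) ^+ s * (T i k (s k) *
  \prod_(m | (i != m) && (m != k)) M m (s m)).
pose P i k (s : {perm 'I_n}) := (s i == j) && (i != k).
have -> : \sum_i \sum_(s : {perm 'I_n} | s i == j) (-1) ^+ s *
    \sum_(k | i != k) T i k (s k) *
      \prod_(m | (i != m) && (m != k)) M m (s m) =
    \sum_i \sum_k \sum_(s | P i k s) F i k s.
  apply: eq_bigr => i _.
  rewrite (exchange_big_dep (fun s : {perm 'I_n} => s i == j)) /=; last first.
    by move=> k s _ /andP[].
  apply: eq_bigr => s sij; rewrite big_distrr /=; apply: eq_bigl => k.
  by rewrite /P sij.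
set S := LHS.
suff SN : S = - S.
  by apply/eqP; rewrite -[_ == _]/((2 == 0)%N || _) -mulrn_eq0 mulr2n {2}SN subrr.
rewrite {1}/S exchange_big /= -sumrN; apply: eq_bigr => i _.
rewrite -sumrN; apply: eq_bigr => k _.
rewrite -sumrN (reindex_inj (mulgI (tperm i k))) /=.
have Fswap s : P k i (tperm i k * s)%g = P i k s.
  by rewrite /P permM tpermR (eq_sym k).
apply: eq_big => // s; rewrite Fswap => /andP[_ ik].
rewrite /F odd_mul_tperm ik signr_addb expr1 !mulNr mul1r permM tpermL Tsym.
congr (- (_ * (_ * _))).
apply: eq_big => m; first by rewrite andbC eq_sym (eq_sym m).
by move=> /andP[km mi]; rewrite permM tpermD // eq_sym.
Qed.

Lemma det_add_delta (R : comRingType) n (W : 'M[R]_n) i j (h : R) :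
  \det (h *: delta_mx i j + W) = h * cofactor W i j + \det W.
Proof.
rewrite (expand_det_row _ i) (expand_det_row W i).
have cE k : cofactor (h *: delta_mx i j + W) i k = cofactor W i k.
  rewrite /cofactor; congr (_ * \det _); apply/matrixP => a b.
  by rewrite !mxE (eq_sym (lift i a)) (negbTE (neq_lift _ _)) mulr0 add0r.
under eq_bigr do rewrite cE !mxE eqxx /= mulrDl.
rewrite big_split /=; congr (_ + _).
rewrite (bigD1 j)//= eqxx mulr1 big1 ?addr0// => k /negbTE->.
by rewrite mulr0 mul0r.
Qed.

(** * Calculus of [Ck] functions of several variables *)

Section derive_line.
Context {R : realType} {V : normedModType R}.
Implicit Types (f : V -> R) (x v : V).

Lemma is_derive_line f x v (t : R) : derivable f (x + t *: v) v ->
  is_derive t 1 (fun s : R => f (x + s *: v)) ('D_v f (x + t *: v)).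
Proof.
move=> df.
have E : (fun h : R => h^-1 *: (((fun s : R => f (x + s *: v)) \o shift t) (h *: 1)
    - f (x + t *: v))) =
  (fun h : R => h^-1 *: ((f \o shift (x + t *: v)) (h *: v) - f (x + t *: v))).
  apply/funext => h /=; congr (_ *: (f _ - _)).
  by rewrite [h *: 1]mulr1 scalerDl addrCA.
by apply: DeriveDef; rewrite /derivable /derive E.
Qed.

Lemma MVT_line f x v (h : R) : 0 < h ->
  (forall t, 0 <= t <= h -> derivable f (x + t *: v) v) ->
  exists2 t, 0 < t < h & f (x + h *: v) - f x = h * 'D_v f (x + t *: v).
Proof.
move=> h0 df.
have [|||t] := @MVT R (fun s => f (x + s *: v)) (fun s => 'D_v f (x + s *: v)) 0 h.
- by [].
- move=> t; rewrite in_itv /= => /andP[/ltW t0 /ltW th].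
  by apply/is_derive_line/df; rewrite t0 th.
- apply: derivable_within_continuous => t; rewrite in_itv /= => tI.
  by have [] := is_derive_line (df _ tI).
- rewrite in_itv /= => tI; rewrite scale0r addr0 subr0 => E.
  by exists t => //; rewrite E mulrC.
Qed.

Lemma MVT_line_abs f x v (h : R) :
  (forall t, `|t| <= `|h| -> derivable f (x + t *: v) v) ->
  exists2 t, `|t| <= `|h| & f (x + h *: v) - f x = h * 'D_v f (x + t *: v).
Proof.
move=> df; have [h0|h0|->] := ltgtP h 0; last first.
- by exists 0; rewrite // scale0r addr0 subrr mul0r.
- have [|t /andP[t0 th] E] := @MVT_line f x v h h0.
    by move=> t /andP[t0 th]; apply: df; rewrite !ger0_norm// ltW.
  by exists t => //; rewrite !ger0_norm// ltW.
- have nh0 : 0 < - h by rewrite oppr_gt0.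
  have [|t /andP[t0 th] E] := @MVT_line f (x + h *: v) v _ nh0.
    move=> t /andP[t0 th]; rewrite -addrA -scalerDl; apply: df.
    by rewrite (ltr0_norm h0) ler0_norm; lra.
  exists (h + t); first by rewrite (ltr0_norm h0) ler0_norm; lra.
  move: E; rewrite -!addrA -!scalerDl subrr scale0r addr0.
  by lra.
Qed.

End derive_line.

Section Ck_theory.
Context {R : realType} (n : nat).
Local Notation V := 'rV[R]_n.
Implicit Types (Om : set V) (f g : V -> R) (x v : V) (k : nat).

Local Notation e i := (delta_mx ord0 i : V).

Lemma near_eq_continuous f g x : (\near x, f x = g x) ->
  {for x, continuous f} -> {for x, continuous g}.
Proof.
move=> fg cf; have fgx : f x = g x := nbhs_singleton fg.
have : f @ x --> g x by rewrite -fgx.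
by apply: cvg_trans; exact: near_eq_cvg fg.
Qed.

Lemma open_near_eq Om f g x : open Om -> Om x -> {in Om, f =1 g} ->
  \near x, f x = g x.
Proof.
move=> oOm Omx fg; have := open_nbhs_nbhs (conj oOm Omx).
by apply: filterS => y Omy; apply: fg; rewrite inE.
Qed.

Lemma CkSP k Om f : Ck k.+1 Om f <->
  (forall x, Om x -> {for x, continuous f} /\ forall i, derivable f x (e i)) /\
  forall i, Ck k Om (partial i f).
Proof.
split=> [H|[H0 H1]].
  split=> [x Omx|i s x sk Omx].
    by have [c d] := H [::] x isT Omx; split => // i; exact: d.
  have := H (rcons s i) x; rewrite size_rcons !ltnS => /(_ sk Omx).
  by rewrite /iter_partial foldr_rcons.
move=> s; case/lastP: s => [|s i] x.
  by move=> _ Omx; have [c d] := H0 x Omx; split.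
rewrite size_rcons !ltnS => sk Omx; rewrite /iter_partial foldr_rcons.
exact: H1.
Qed.

Lemma Ck0P Om f : Ck 0 Om f <-> forall x, Om x -> {for x, continuous f}.
Proof.
split=> [H x Omx|H [|//] x _ Omx]; first by have [] := H [::] x isT Omx.
by split => //; exact: H.
Qed.

Lemma Ck_le j k Om f : (j <= k)%N -> Ck k Om f -> Ck j Om f.
Proof.
move=> jk H s x sj Omx; have [c d] := H s x (leq_trans sj jk) Omx.
by split => // sj' i; apply: d; exact: leq_trans sj' jk.
Qed.

Lemma Ck_continuous k Om f x : Ck k Om f -> Om x -> {for x, continuous f}.
Proof. by move=> /(_ [::] x isT) H /H[]. Qed.

Lemma Ck_derivable k Om f x i : Ck k.+1 Om f -> Om x -> derivable f x (e i).
Proof. by move=> /CkSP[H _] /H[_]. Qed.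

Arguments Ck_derivable {k Om f x} i _ _.

Lemma Ck_partial k Om f i : Ck k.+1 Om f -> Ck k Om (partial i f).
Proof. by move=> /CkSP[_]. Qed.

Lemma Ck_eq k Om f g : open Om -> {in Om, f =1 g} -> Ck k Om f -> Ck k Om g.
Proof.
move=> oOm; elim: k f g => [f g fg|k ih f g fg].
  rewrite !Ck0P => H x Omx.
  by apply: near_eq_continuous (H x Omx); exact: open_near_eq fg.
move=> /CkSP[H0 H1]; apply/CkSP; split=> [x Omx|i].
  have [c d] := H0 x Omx; have fgx := open_near_eq oOm Omx fg.
  split; first exact: near_eq_continuous c.
  by move=> i; exact: near_eq_derivable (d i).
apply: ih (H1 i) => x; rewrite inE => Omx.
by apply: near_eq_derive; exact: open_near_eq fg.
Qed.

Lemma Ck_cst k Om (c : R) : Ck k Om (fun=> c).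
Proof.
elim: k c => [c|k ih c]; first by apply/Ck0P => x _; exact: cst_continuous.
apply/CkSP; split=> [x _|i]; first by split=> [|i]; [exact: cst_continuous|exact: derivable_cst].
rewrite (_ : partial i _ = fun=> 0)//; apply/funext => x.
by rewrite /partial derive_cst.
Qed.

Lemma partialD f g i x : derivable f x (e i) -> derivable g x (e i) ->
  partial i (fun y => f y + g y) x = partial i f x + partial i g x.
Proof. by move=> df dg; exact: (deriveD df dg). Qed.

Lemma partialM f g i x : derivable f x (e i) -> derivable g x (e i) ->
  partial i (fun y => f y * g y) x = f x * partial i g x + g x * partial i f x.
Proof. by move=> df dg; exact: (deriveM df dg). Qed.

Lemma CkD k Om f g : open Om -> Ck k Om f -> Ck k Om g ->
  Ck k Om (fun y => f y + g y).
Proof.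
move=> oOm; elim: k f g => [f g|k ih f g].
  rewrite !Ck0P => Hf Hg x Omx; exact: cvgD (Hf x Omx) (Hg x Omx).
move=> /CkSP[f0 f1] /CkSP[g0 g1]; apply/CkSP; split=> [x Omx|i].
  have [cf df] := f0 x Omx; have [cg dg] := g0 x Omx.
  by split=> [|i]; [exact: cvgD cf cg|exact: derivableD].
apply: Ck_eq (ih _ _ (f1 i) (g1 i)) => // x; rewrite inE => Omx.
have [_ df] := f0 x Omx; have [_ dg] := g0 x Omx.
by rewrite partialD.
Qed.

Lemma CkM k Om f g : open Om -> Ck k Om f -> Ck k Om g ->
  Ck k Om (fun y => f y * g y).
Proof.
move=> oOm; elim: k f g => [f g|k ih f g].
  rewrite !Ck0P => Hf Hg x Omx; exact: cvgM (Hf x Omx) (Hg x Omx).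
move=> Cf Cg; have Cf' := Ck_le (leqnSn _) Cf; have Cg' := Ck_le (leqnSn _) Cg.
move: Cf Cg => /CkSP[f0 f1] /CkSP[g0 g1]; apply/CkSP; split=> [x Omx|i].
  have [cf df] := f0 x Omx; have [cg dg] := g0 x Omx.
  by split=> [|i]; [exact: cvgM cf cg|exact: derivableM].
apply: Ck_eq (CkD oOm (ih _ _ Cf' (g1 i)) (ih _ _ Cg' (f1 i))) => //.
move=> x; rewrite inE => Omx.
have [_ df] := f0 x Omx; have [_ dg] := g0 x Omx.
by rewrite partialM.
Qed.

Lemma Ck_sum k Om (I : Type) (r : seq I) (P : pred I) (F : I -> V -> R) :
  open Om -> (forall i, Ck k Om (F i)) ->
  Ck k Om (fun x => \sum_(i <- r | P i) F i x).
Proof.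
move=> oOm CF; elim: r => [|a r ih].
  by under eq_fun do rewrite big_nil; exact: Ck_cst.
under eq_fun do rewrite big_cons.
by case: (P a); [exact: CkD oOm (CF a) ih|exact: ih].
Qed.

Lemma Ck_prod k Om (I : Type) (r : seq I) (P : pred I) (F : I -> V -> R) :
  open Om -> (forall i, Ck k Om (F i)) ->
  Ck k Om (fun x => \prod_(i <- r | P i) F i x).
Proof.
move=> oOm CF; elim: r => [|a r ih].
  by under eq_fun do rewrite big_nil; exact: Ck_cst.
under eq_fun do rewrite big_cons.
by case: (P a); [exact: CkM oOm (CF a) ih|exact: ih].
Qed.

Lemma CkN k Om f : open Om -> Ck k Om f -> Ck k Om (fun x => - f x).
Proof.
move=> oOm Cf; have C1 : Ck k Om (fun=> -1 : R) by exact: Ck_cst.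
apply: Ck_eq (CkM oOm C1 Cf) => // x _.
by rewrite mulN1r.
Qed.

Lemma is_derive_sum_seq (I : Type) (r : seq I) (P : pred I) (F : I -> V -> R)
    (dF : I -> R) x v :
  (forall i, is_derive x v (F i) (dF i)) ->
  is_derive x v (fun y => \sum_(i <- r | P i) F i y) (\sum_(i <- r | P i) dF i).
Proof.
move=> HF; elim: r => [|a r ih].
  rewrite big_nil; under eq_fun do rewrite big_nil.
  exact: is_derive_cst.
rewrite big_cons; under eq_fun do rewrite big_cons.
by case: (P a) => //; exact: is_deriveD.
Qed.

Lemma is_derive_prod_seq (I : eqType) (r : seq I) (P : pred I) (F : I -> V -> R)
    (dF : I -> R) x v : uniq r ->
  (forall i, is_derive x v (F i) (dF i)) ->
  is_derive x v (fun y => \prod_(i <- r | P i) F i y)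
    (\sum_(k <- r | P k) dF k * \prod_(m <- r | P m && (m != k)) F m x).
Proof.
move=> + HF; elim: r => [_|a r ih /= /andP[ar ur]].
  rewrite big_nil; under eq_fun do rewrite big_nil.
  exact: is_derive_cst.
rewrite big_cons; under eq_fun do rewrite big_cons.
have E : \sum_(k <- r | P k) dF k * \prod_(m <- a :: r | P m && (m != k)) F m x =
  (if P a then F a x else 1) *
  \sum_(k <- r | P k) dF k * \prod_(m <- r | P m && (m != k)) F m x.
  rewrite big_distrr /= big_seq_cond [RHS]big_seq_cond.
  apply: eq_bigr => k /andP[kr _].
  have ak : a != k by apply: contraNneq ar => ->.
  rewrite big_cons ak andbT; case: (P a); last by rewrite mul1r.
  by rewrite mulrCA.
rewrite E; case: (boolP (P a)) => Pa; last by rewrite mul1r; exact: ih.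
apply: is_derive_eq; first exact: (is_deriveM (HF a) (ih ur)).
rewrite addrC /= big_cons Pa eqxx /= [_ *: dF a]mulrC; congr (_ * _ + _).
rewrite big_seq_cond [RHS]big_seq_cond; apply: eq_bigl => m.
by have [mr|//] := boolP (m \in r); rewrite (_ : m != a) ?andbT//;
  apply: contraNneq ar => <-.
Qed.

(** By the mean value theorem along one axis.  The base point moves with [h],
    which is what allows the increments along the axes to be added one after
    the other in [Ck1_is_derive]. *)
Lemma cvg_partial_shifted Om f x (u : V) (c : R) i : open Om -> Ck 1 Om f -> Om x ->
  h^-1 * (f (x + h *: u + (h * c) *: e i) - f (x + h *: u)) @[h --> (0 : R)^']
    --> c * partial i f x.
Proof.
move=> oOm Cf Omx.
pose N := `|u| + `|c| * `|e i| + 1.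
have N0 : 0 < N by rewrite ltr_wpDl// addr_ge0// mulr_ge0.
have Cg : {for x, continuous (partial i f)}.
  exact: Ck_continuous (Ck_partial i Cf) Omx.
apply/cvgrPdist_le => eps eps0.
have c10 : 0 < `|c| + 1 by rewrite ltr_wpDl.
have eps'0 : 0 < eps / (`|c| + 1) by rewrite divr_gt0.
have near1 : \forall y \near x, Om y /\
    `|partial i f x - partial i f y| <= eps / (`|c| + 1).
  apply: filterI; first exact: open_nbhs_nbhs.
  by move/cvgrPdist_le : Cg => /(_ _ eps'0).
have /nbhs_ballP[d /= d0 Hd] := near1.
have dN : 0 < d / N by rewrite divr_gt0.
near=> h.
have hd : `|h| < d / N.
  near: h; apply: dnbhs0_lt => //.
have h0 : h != 0 by near: h; exact: nbhs_dnbhs_neq.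
have inball t : `|t| <= `|h * c| -> ball x d (x + h *: u + t *: e i).
  move=> tle; rewrite -ball_normE /= -addrA opprD addrA subrr sub0r normrN.
  apply: (le_lt_trans (ler_normD _ _)); rewrite !normrZ.
  apply: (@le_lt_trans _ _ (`|h| * N)); last by rewrite -ltr_pdivlMr.
  rewrite /N !mulrDr mulr1 -addrA lerD2l mulrA -normrM.
  by rewrite (@le_trans _ _ (`|h * c| * `|e i|)) ?ler_wpM2r// lerDl.
have [t tle ->] := @MVT_line_abs R V f (x + h *: u) (e i) (h * c) (fun t tle =>
    Ck_derivable _ Cf (Hd _ (inball t tle)).1).
have [_ Ht] := Hd _ (inball t tle).
rewrite !mulrA mulVf// mul1r -mulrBr normrM.
apply: (@le_trans _ _ (`|c| * (eps / (`|c| + 1)))); first by rewrite ler_wpM2l.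
rewrite mulrCA ler_piMr ?ltW// ltr_pdivrMr// mul1r.
by rewrite ltrDl.
Unshelve. all: by end_near. Qed.

Lemma Ck1_is_derive Om f x v : open Om -> Ck 1 Om f -> Om x ->
  is_derive x v f (\sum_(i < n) v ord0 i * partial i f x).
Proof.
move=> oOm Cf Omx.
suff H (r : seq 'I_n) : is_derive x (\sum_(i <- r) v ord0 i *: e i) f
    (\sum_(i <- r) v ord0 i * partial i f x).
  by have := H (index_enum 'I_n); rewrite -row_sum_delta.
elim: r => [|i r ih]; first by rewrite !big_nil; exact: is_derive0.
rewrite !big_cons; set u := \sum_(i <- r) _ in ih *; set s := \sum_(i <- r) _ in ih *.
have cu : h^-1 * (f (x + h *: u) - f x) @[h --> (0 : R)^'] --> s.
  have [dfu <-] := ih; rewrite /derive.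
  rewrite (_ : (fun h => _) = (fun h => h^-1 *: ((f \o shift x) (h *: u) - f x))) //.
  by apply/funext => h /=; rewrite (addrC x).
have ci := @cvg_partial_shifted Om f x u (v ord0 i) i oOm Cf Omx.
have C := cvgD ci cu.
have E : (fun h : R => h^-1 *: ((f \o shift x) (h *: (v ord0 i *: e i + u)) - f x)) =
  (fun h => h^-1 * (f (x + h *: u + (h * v ord0 i) *: e i) - f (x + h *: u)) +
    h^-1 * (f (x + h *: u) - f x)).
  apply/funext => h /=; rewrite -mulrDr addrA subrK; congr (_ * (f _ - _)).
  by rewrite scalerDr scalerA addrC (addrC ((h * _) *: _)) addrA.
apply: DeriveDef; rewrite /derivable /derive E; last by apply: cvg_lim => //; exact: C.
by apply/cvg_ex; eexists; exact: C.
Qed.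

(** Difference quotients are identified as functions, which transfers
    derivability and the value of the derivative at once. *)
Lemma growth_rate_shift f i (a x : V) :
  (fun h : R => h^-1 *: (((fun y => f (y + a)) \o shift x) (h *: e i) - f (x + a))) =
  (fun h : R => h^-1 *: ((f \o shift (x + a)) (h *: e i) - f (x + a))).
Proof. by apply/funext => h /=; rewrite addrA. Qed.

Lemma partial_shift f i (a x : V) :
  partial i (fun y => f (y + a)) x = partial i f (x + a).
Proof. by rewrite /partial /derive growth_rate_shift. Qed.

Lemma derivable_shift f i (a x : V) : derivable f (x + a) (e i) ->
  derivable (fun y => f (y + a)) x (e i).
Proof. by rewrite /derivable growth_rate_shift. Qed.

(** The mean value theorem is applied to [f (y + h e_j) - f y] in the direction
    [e_i], then to [partial i f] in the direction [e_j].  The second difference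
    being symmetric in [i] and [j], its limit yields [partialC]. *)
Lemma second_difference_le Om f x i j (eps : R) : open Om -> Ck 2 Om f -> Om x ->
  0 < eps -> \forall h \near (0 : R)^',
  `|f (x + h *: e i + h *: e j) - f (x + h *: e i) - f (x + h *: e j) + f x
    - h ^+ 2 * partial j (partial i f) x| <= eps * h ^+ 2.
Proof.
move=> oOm Cf Omx eps0.
have Cf1 := Ck_le (isT : (1 <= 2)%N) Cf.
have Cg : {for x, continuous (partial j (partial i f))}.
  exact: Ck_continuous (Ck_partial j (Ck_partial i Cf)) Omx.
have near1 : \forall y \near x, Om y /\
    `|partial j (partial i f) y - partial j (partial i f) x| <= eps.
  apply: filterI; first exact: open_nbhs_nbhs.
  by move/cvgrPdistC_le : Cg => /(_ _ eps0).
have /nbhs_ballP[d /= d0 Hd] := near1.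
pose N := `|e i| + `|e j| + 1.
have N0 : 0 < N by rewrite ltr_wpDl// addr_ge0.
have dN : 0 < d / N by rewrite divr_gt0.
near=> h.
have hd : `|h| < d / N.
  near: h; apply: dnbhs0_lt => //.
have inball s t : `|s| <= `|h| -> `|t| <= `|h| -> ball x d (x + s *: e i + t *: e j).
  move=> sle tle; rewrite -ball_normE /= -addrA opprD addrA subrr sub0r normrN.
  apply: (le_lt_trans (ler_normD _ _)); rewrite !normrZ.
  apply: (@le_lt_trans _ _ (`|h| * N)); last by rewrite -ltr_pdivlMr.
  rewrite /N !mulrDr mulr1 -addrA lerD ?ler_wpM2r//.
  by rewrite (@le_trans _ _ (`|h| * `|e j|)) ?ler_wpM2r// lerDl.
have inball0 s : `|s| <= `|h| -> ball x d (x + s *: e i).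
  by move=> sh; have := inball s 0 sh; rewrite normr0 scale0r addr0; exact.
pose F y := f (y + h *: e j) - f y.
have dF1 s : `|s| <= `|h| -> derivable (fun y => f (y + h *: e j)) (x + s *: e i) (e i).
  by move=> sh; apply/derivable_shift/(Ck_derivable _ Cf1)/(Hd _ (inball s h sh _)).1.
have dF2 s : `|s| <= `|h| -> derivable f (x + s *: e i) (e i).
  by move=> sh; apply/(Ck_derivable _ Cf1)/(Hd _ (inball0 s sh)).1.
have [s sh] := @MVT_line_abs R V F x (e i) h (fun s sh =>
  derivableB (dF1 s sh) (dF2 s sh)).
rewrite [X in _ = h * X](_ : _ = partial i f (x + s *: e i + h *: e j)
    - partial i f (x + s *: e i)); last first.
  rewrite -partial_shift /partial -deriveB//; [exact: dF1|exact: dF2].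
have [t th ->] := @MVT_line_abs R V (partial i f) (x + s *: e i) (e j) h (fun t th =>
  Ck_derivable _ (Ck_partial i Cf) (Hd _ (inball s t sh th)).1).
have [_ Ht] := Hd _ (inball s t sh th).
rewrite /F opprB addrA addrAC => ->.
rewrite mulrA -expr2 -mulrBr normrM normrX real_normK ?num_real// mulrC.
apply: ler_wpM2r; first exact: sqr_ge0.
exact: Ht.
Unshelve. all: by end_near. Qed.

Let dist_le_of_common (k a b D D1 D2 D3 eps : R) : 0 < k ->
  `|D - D1 - D2 + D3 - k * b| <= eps / 2 * k ->
  `|D - D2 - D1 + D3 - k * a| <= eps / 2 * k -> `|a - b| <= eps.
Proof.
move=> k0 h1 h2; rewrite -(ler_pM2l k0) -{1}(gtr0_norm k0) -normrM.
have -> : k * (a - b) = (D - D1 - D2 + D3 - k * b) - (D - D2 - D1 + D3 - k * a).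
  by ring.
apply: (le_trans (ler_normB _ _)); apply: (le_trans (lerD h1 h2)).
by rewrite le_eqVlt; apply/orP; left; apply/eqP; field.
Qed.

Lemma partialC Om f x i j : open Om -> Ck 2 Om f -> Om x ->
  partial i (partial j f) x = partial j (partial i f) x.
Proof.
move=> oOm Cf Omx; apply/eqP; rewrite -subr_eq0 -normr_le0.
apply/ler_addgt0Pr => eps eps0; rewrite add0r.
have eps20 : 0 < eps / 2 by rewrite divr_gt0.
have Hij := @second_difference_le Om f x i j _ oOm Cf Omx eps20.
have Hji := @second_difference_le Om f x j i _ oOm Cf Omx eps20.
have nz : \forall h \near (0 : R)^', h != 0 by exact: nbhs_dnbhs_neq.
have [h [[h1 h2] h0]] := filter_ex (filterI (filterI Hij Hji) nz).
have hh : 0 < h ^+ 2 by rewrite exprn_even_gt0.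
rewrite (addrAC x) in h2.
exact: dist_le_of_common hh h1 h2.
Qed.

Lemma hessian_sym Om f x : open Om -> Ck 2 Om f -> Om x ->
  (hessian f x)^T = hessian f x.
Proof.
by move=> oOm Cf Omx; apply/matrixP => i j; rewrite !mxE (partialC i j oOm Cf Omx).
Qed.

End Ck_theory.

Arguments Ck_derivable {R n k Om f x} i _ _.
Arguments Ck_partial {R n k Om f} i _.

(** * Second-order conditions at extrema *)

Section extrema.
Context {R : realType} (n : nat).
Local Notation V := 'rV[R]_n.
Implicit Types (Om : set V) (f w : V -> R) (x v : V).

Local Notation e i := (delta_mx ord0 i : V).

Lemma open_line Om x v : open Om -> Om x ->
  exists2 d : R, 0 < d & forall t, `|t| < d -> Om (x + t *: v).
Proof.
move=> oOm Omx.
have /nbhs_ballP[d /= d0 Hd] : nbhs x Om by exact: open_nbhs_nbhs.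
have v10 : 0 < `|v| + 1 by rewrite ltr_wpDl.
exists (d / (`|v| + 1)); first by rewrite divr_gt0.
move=> t; rewrite ltr_pdivlMr// => td; apply: Hd.
rewrite -ball_normE /= opprD addrA subrr sub0r normrN normrZ.
by apply: le_lt_trans td; rewrite ler_wpM2l// lerDl.
Qed.

Definition dir_deriv v f x : R := \sum_(i < n) v ord0 i * partial i f x.

Lemma is_derive_dir Om f x v : open Om -> Ck 1 Om f -> Om x ->
  is_derive x v f (dir_deriv v f x).
Proof. exact: Ck1_is_derive. Qed.

Lemma dir_deriv_eq0 Om f x v : open Om -> Ck 1 Om f -> Om x ->
  (forall y, Om y -> f y <= f x) \/ (forall y, Om y -> f x <= f y) ->
  dir_deriv v f x = 0.
Proof.
move=> oOm Cf Omx ext; have [d d0 Hd] := open_line v oOm Omx.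
have Omt t : t \in `]- d, d[%R -> Om (x + t *: v).
  by rewrite in_itv /= => tI; apply: Hd; rewrite ltr_norml.
have D t : t \in `]- d, d[%R ->
    is_derive t 1 (fun s : R => f (x + s *: v)) (dir_deriv v f (x + t *: v)).
  move=> tI; have [df <-] := is_derive_dir v oOm Cf (Omt t tI).
  exact: is_derive_line.
have I0 : 0 \in `]- d, d[%R by rewrite in_itv /= oppr_lt0 d0.
have [_] := D 0 I0; rewrite scale0r addr0 => <-.
have dd : - d <= d by rewrite (@le_trans _ _ 0) ?oppr_le0 ?ltW.
have dg t : t \in `]- d, d[%R -> derivable (fun s : R => f (x + s *: v)) t 1.
  by move=> tI; case: (D t tI).
have x0 : x + 0 *: v = x by rewrite scale0r addr0.
case: ext => ext.
  have [|_ ->//] := derive1_at_max dd dg I0.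
  by move=> t tI; rewrite x0; exact/ext/Omt.
have [|_ ->//] := derive1_at_min dd dg I0.
by move=> t tI; rewrite x0; exact/ext/Omt.
Qed.

Lemma partial_eq0_at_max Om f x i : open Om -> Ck 1 Om f -> Om x ->
  (forall y, Om y -> f y <= f x) -> partial i f x = 0.
Proof.
move=> oOm Cf Omx /or_introl H.
rewrite -[RHS](dir_deriv_eq0 (e i) oOm Cf Omx (H _)) /dir_deriv (bigD1 i)//= big1.
  by rewrite !mxE !eqxx mul1r addr0.
by move=> j ji; rewrite !mxE (negbTE ji) andbF mul0r.
Qed.

(** On a line through the minimum the first derivative vanishes at the minimum
    and, by the mean value theorem, is nonnegative at points arbitrarily close
    to it on the right; so the second derivative cannot be negative. *)
Lemma hessian_psd_at_min Om f x v : open Om -> Ck 2 Om f -> Om x ->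
  (forall y, Om y -> f x <= f y) -> 0 <= bil (hessian f x) v v.
Proof.
move=> oOm Cf Omx fmin.
have Cf1 : Ck 1 Om f by exact: Ck_le Cf.
have Dx0 : dir_deriv v f x = 0.
  by apply: dir_deriv_eq0 oOm Cf1 Omx _; right.
have CD : Ck 1 Om (dir_deriv v f).
  apply: (Ck_sum _ _ oOm) => i; apply: (CkM oOm); first exact: Ck_cst.
  exact: Ck_partial.
have -> : bil (hessian f x) v v = dir_deriv v (dir_deriv v f) x.
  rewrite bilE; apply: eq_bigr => i _.
  have -> : partial i (dir_deriv v f) x =
      \sum_j v ord0 j * partial i (partial j f) x.
    have Dj j : is_derive x (e i) (fun y => v ord0 j * partial j f y)
        (v ord0 j * partial i (partial j f) x).
      have /derivableP := Ck_derivable i (Ck_partial j Cf) Omx.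
      exact: is_deriveZ.
    by have [_] := is_derive_sum_seq (index_enum 'I_n) xpredT Dj.
  by rewrite big_distrr /=; apply: eq_bigr => j _; rewrite mxE mulrA.
rewrite leNgt; apply/negP => D2.
have [dD DE] := is_derive_dir v oOm CD Omx.
have c : (fun h : R => h^-1 *: ((dir_deriv v f \o shift x) (h *: v) - dir_deriv v f x))
    @ 0^' --> dir_deriv v (dir_deriv v f) x.
  by rewrite -DE; exact: dD.
have : \forall h \near (0 : R)^',
    h^-1 *: ((dir_deriv v f \o shift x) (h *: v) - dir_deriv v f x) < 0.
  have := D2; apply: cvgr_lt; exact: c.
move=> [d1 /= d10 Hd1].
have [d d0 Hd] := open_line v oOm Omx.
pose h := Num.min d d1 / 2.
have m0 : 0 < Num.min d d1 by rewrite lt_min d0.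
have h0 : 0 < h by rewrite divr_gt0.
have hm : h < Num.min d d1 by rewrite ltr_pdivrMr// ltr_pMr// ltr1n.
move: hm; rewrite lt_min => /andP[hd hd1].
have Omt t : 0 <= t <= h -> Om (x + t *: v).
  by move=> /andP[t0 th]; apply: Hd; rewrite ger0_norm// (le_lt_trans th).
have [t tI|t /andP[t0 th] E] := @MVT_line R V f x v h h0.
  by have [] := is_derive_dir v oOm Cf1 (Omt t tI).
have tI : 0 <= t <= h by rewrite !ltW.
have := Hd1 t; rewrite /= sub0r normrN gtr0_norm// => /(_ (lt_trans th hd1)).
rewrite gt_eqF// => /(_ isT); rewrite Dx0 subr0 pmulr_rlt0 ?invr_gt0//.
apply/negP; rewrite -leNgt.
have := fmin _ (Omt h _); rewrite lexx ltW// -subr_ge0 E pmulr_rge0// => /(_ isT).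
have [_ ->] := is_derive_dir v oOm Cf1 (Omt t tI).
by rewrite addrC.
Qed.

Lemma is_derive_coord x v i : is_derive x v (fun y : V => y ord0 i) (v ord0 i).
Proof.
have D : differentiable (fun y : V => y ord0 i) x by exact: differentiable_coord.
apply: DeriveDef; first exact: diff_derivable.
apply: cvg_lim => //; apply: cvg_near_cst.
near=> h; have h0 : h != 0 by near: h; exact: nbhs_dnbhs_neq.
by rewrite /= !mxE addrK [LHS]mulrA mulVf// mul1r.
Unshelve. all: by end_near. Qed.

Lemma is_derive_coordB x v i (c : R) :
  is_derive x v (fun y : V => y ord0 i - c) (v ord0 i).
Proof.
have := is_deriveB (is_derive_coord x v i) (is_derive_cst c x v).
by rewrite subr0.
Qed.

Lemma partial_coord i j x : partial i (fun y : V => y ord0 j) x = (i == j)%:R.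
Proof.
by have [_] := is_derive_coord x (e i) j; rewrite /partial => ->; rewrite mxE eqxx eq_sym.
Qed.

Lemma Ck_coord k Om i : Ck k Om (fun y : V => y ord0 i).
Proof.
have c x : {for x, continuous (fun y : V => y ord0 i)}.
  exact/differentiable_continuous/differentiable_coord.
case: k => [|k]; first by apply/Ck0P => x _.
apply/CkSP; split=> [x _|j]; first by split => // j; case: (is_derive_coord x (e j) i).
rewrite (_ : partial j _ = fun=> (j == i)%:R); first exact: Ck_cst.
by apply/funext => x; rewrite partial_coord.
Qed.

Definition sqdist (a x : V) : R := \sum_(i < n) (x ord0 i - a ord0 i) ^+ 2.

Lemma is_derive_sqdist a x j :
  is_derive x (e j) (sqdist a) (2 * (x ord0 j - a ord0 j)).
Proof.
have D i : is_derive x (e j) (fun y : V => (y ord0 i - a ord0 i) ^+ 2)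
    (2 * (x ord0 i - a ord0 i) * (j == i)%:R).
  have D2 : is_derive x (e j) (fun y : V => y ord0 i - a ord0 i) ((j == i)%:R).
    by have := is_derive_coordB x (e j) i (a ord0 i); rewrite mxE eqxx eq_sym.
  under eq_fun do rewrite expr2.
  have := is_deriveM D2 D2 => /is_derive_eq; apply.
  by rewrite /GRing.scale /=; ring.
have := is_derive_sum_seq (index_enum 'I_n) xpredT D.
move=> /is_derive_eq; apply; rewrite (bigD1 j)//= eqxx mulr1 big1 ?addr0// => i ij.
by rewrite eq_sym (negbTE ij) mulr0.
Qed.

Lemma Ck_sqdist k Om a : open Om -> Ck k Om (sqdist a).
Proof.
move=> oOm; apply: (Ck_sum _ _ oOm) => i; under eq_fun do rewrite expr2.
have C : Ck k Om (fun y : V => y ord0 i - a ord0 i).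
  by apply: (CkD oOm); [exact: Ck_coord|exact: Ck_cst].
exact: (CkM oOm C C).
Qed.

Lemma hessian_ge_at_min_sub_sqdist Om w a x v (c : R) : open Om -> Ck 2 Om w -> Om x ->
  (forall y, Om y -> w x - c * sqdist a x <= w y - c * sqdist a y) ->
  2 * c * \sum_i v ord0 i ^+ 2 <= bil (hessian w x) v v.
Proof.
move=> oOm Cw Omx wmin.
have Cq : Ck 2 Om (fun y => - (c * sqdist a y)).
  by apply: (CkN oOm); apply: (CkM oOm); [exact: Ck_cst|exact: Ck_sqdist].
have := hessian_psd_at_min v oOm (CkD oOm Cw Cq) Omx wmin.
suff -> : hessian (fun y => w y - c * sqdist a y) x = hessian w x - (2 * c)%:M.
  rewrite bilB subr_ge0; congr (_ <= _).
  rewrite -scalemx1 /bil -scalemxAr -scalemxAl mxE; congr (_ * _).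
  exact: bil1.
have Dq y j : is_derive y (e j) (fun z => - (c * sqdist a z))
    (- (2 * c * (y ord0 j - a ord0 j))).
  have := is_deriveN (is_deriveZ c (is_derive_sqdist a y j)).
  by move=> /is_derive_eq; apply; rewrite /GRing.scale /=; ring.
apply/matrixP => i j; rewrite !mxE.
have E : {in Om, partial j (fun y => w y - c * sqdist a y) =1
    (fun y => partial j w y - 2 * c * (y ord0 j - a ord0 j))}.
  move=> y; rewrite inE => Omy; rewrite partialD.
  - by have [_] := Dq y j; rewrite /partial => ->.
  - exact: Ck_derivable _ Cw Omy.
  - by case: (Dq y j).
rewrite [LHS](near_eq_derive _ (open_near_eq oOm Omx E)).
have D1 := derivableP (Ck_derivable i (Ck_partial j Cw) Omx).
have D2 : is_derive x (e i) (fun y : V => y ord0 j - a ord0 j) ((i == j)%:R).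
  by have := is_derive_coordB x (e i) j (a ord0 j); rewrite mxE eqxx eq_sym.
have [_ ->] := is_deriveB D1 (is_deriveZ (2 * c) D2).
by rewrite /GRing.scale /= mulr_natr.
Qed.

End extrema.

(** * Divergence of the cofactor matrix of a Hessian *)

Section cofactor_divergence.
Context {R : realType} (n : nat).
Local Notation V := 'rV[R]_n.
Implicit Types (Om : set V) (w : V -> R) (x : V).

Local Notation e i := (delta_mx ord0 i : V).

Lemma partial_entry_det (W : 'M[R]_n) i j :
  partial_entry (fun M : 'M[R]_n => \det M) i j W = cofactor W i j.
Proof.
apply: cvg_lim => //; apply: cvg_near_cst.
near=> h; have h0 : h != 0 by near: h; exact: nbhs_dnbhs_neq.
by rewrite /= det_add_delta addrK [LHS]mulrA mulVf// mul1r.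
Unshelve. all: by end_near. Qed.

Lemma hessian_entryE w i j : (fun x => hessian w x i j) = partial i (partial j w).
Proof. by apply/funext => x; rewrite mxE. Qed.

Lemma Ck_hessian k Om w i j : Ck k.+2 Om w -> Ck k Om (fun x => hessian w x i j).
Proof. by move=> Cw; rewrite hessian_entryE; exact/Ck_partial/Ck_partial. Qed.

Lemma Ck_cofactor k Om w i j : open Om -> Ck k.+2 Om w ->
  Ck k Om (fun x => cofactor (hessian w x) i j).
Proof.
move=> oOm Cw; under eq_fun do rewrite expand_cofactor.
apply: (Ck_sum _ _ oOm) => s; apply: (CkM oOm); first exact: Ck_cst.
by apply: (Ck_prod _ _ oOm) => l; exact: Ck_hessian.
Qed.

(** The Piola identity: [cofactor_deriv_sum0] for the third derivatives of [w],
    the symmetry of which is [partialC]. *)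
Lemma cofactor_hessian_div0 Om w x j : open Om -> Ck 3 Om w -> Om x ->
  \sum_i partial i (fun y => cofactor (hessian w y) i j) x = 0.
Proof.
move=> oOm Cw Omx.
pose T i k l := partial i (partial k (partial l w)) x.
have Tsym i k l : T i k l = T k i l.
  exact: partialC oOm (Ck_partial l Cw) Omx.
rewrite -[RHS](cofactor_deriv_sum0 (hessian w x) j Tsym).
apply: eq_bigr => i _.
have Dh k l : is_derive x (e i) (fun y => hessian w y k l) (T i k l).
  rewrite hessian_entryE; apply: derivableP.
  exact: Ck_derivable _ (Ck_partial k (Ck_partial l Cw)) Omx.
rewrite /partial; under eq_fun do rewrite expand_cofactor.
have D (s : {perm 'I_n}) := is_deriveZ ((-1) ^+ s) (is_derive_prod_seq
  (fun k => i != k) (index_enum_uniq _) (fun k => Dh k (s k))).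
have [_ ->//] := is_derive_sum_seq (index_enum {perm 'I_n}) (fun s => s i == j) D.
Qed.

(** The field [(cofactor - c) grad w].  For a solution of [det = Lap], [c = 1]
    is the flux of the linearized operator and [c = n] makes it divergence
    free. *)
Definition flux w (c : R) (i : 'I_n) x : R :=
  \sum_(j < n) (cofactor (hessian w x) i j - c * (i == j)%:R) * partial j w x.

Lemma Ck_flux Om w c i : open Om -> Ck 3 Om w -> Ck 1 Om (flux w c i).
Proof.
move=> oOm Cw; apply: (Ck_sum _ _ oOm) => j; apply: (CkM oOm).
  by apply: (CkD oOm); [exact: Ck_cofactor|exact: Ck_cst].
by apply/Ck_partial; apply: Ck_le Cw.
Qed.

Lemma div_flux Om w c x : open Om -> Ck 3 Om w -> Om x ->
  \sum_i partial i (flux w c i) x = n%:R * \det (hessian w x) - c * laplacian w x.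
Proof.
move=> oOm Cw Omx.
pose W := hessian w x.
have Cw2 : Ck 2 Om w by exact: Ck_le Cw.
have Dfl i : partial i (flux w c i) x =
   \sum_j (partial i (fun y => cofactor (hessian w y) i j) x * partial j w x
      + (cofactor W i j - c * (i == j)%:R) * W i j).
  have D j : is_derive x (e i)
      (fun y => (cofactor (hessian w y) i j - c * (i == j)%:R) * partial j w y)
      (partial i (fun y => cofactor (hessian w y) i j) x * partial j w x
      + (cofactor W i j - c * (i == j)%:R) * W i j).
    have D1 := derivableP (Ck_derivable i (Ck_cofactor i j oOm Cw) Omx).
    have D2 := derivableP (Ck_derivable i (Ck_partial j Cw2) Omx).
    have := is_deriveM (is_deriveB D1 (is_derive_cst (c * (i == j)%:R) x (e i))) D2.
    move=> /is_derive_eq; apply; rewrite subr0 addrC; congr (_ + _).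
      exact: mulrC.
    by rewrite /W mxE.
  by have [_] := is_derive_sum_seq (index_enum 'I_n) xpredT D.
under eq_bigr do rewrite Dfl big_split /=.
rewrite big_split /= exchange_big /=.
under eq_bigr do rewrite -mulr_suml (cofactor_hessian_div0 _ oOm Cw Omx) mul0r.
rewrite big1_eq add0r.
under eq_bigr => i _.
  under eq_bigr do rewrite mulrBl.
  rewrite sumrB (_ : \sum_j cofactor W i j * W i j = \det W); last first.
    by rewrite (expand_det_row W i); apply: eq_bigr => j _; rewrite mulrC.
  rewrite (_ : \sum_j _ = c * W i i); last first.
    rewrite (bigD1 i)//= eqxx mulr1 big1 ?addr0// => j ji.
    by rewrite eq_sym (negbTE ji) mulr0 mul0r.
  over.
rewrite sumrB sumr_const card_ord mulr_natl; congr (_ - _).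
by rewrite -big_distrr /=; congr (_ * _); apply: eq_bigr => i _; rewrite mxE.
Qed.

End cofactor_divergence.

(** * Borel sets and integration by parts in [R^n] *)

Section measurability_rV.
Context {R : realType} (n : nat).
Local Notation V := 'rV[R]_n.
Implicit Types (Om A : set V) (f : V -> R) (x y : V).

Lemma coord_le_norm x i : `|x ord0 i| <= `|x|.
Proof.
by rewrite [leRHS]/Num.norm /= mx_normrE; apply/bigmax_geP; right => /=; exists (ord0, i).
Qed.

Lemma ball_rVP x y (d : R) : 0 < d ->
  (forall i, `|x ord0 i - y ord0 i| < d) -> ball x d y.
Proof.
by move=> d0 H; split=> // i j; rewrite ord1; exact: H.
Qed.

Lemma measurable_box (A : 'I_n -> set R) : (forall i, measurable (A i)) ->
  measurable [set x : V | forall i, A i (x ord0 i)].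
Proof.
move=> mA; rewrite (_ : [set _ | _] = \bigcap_(j in [set: 'I_n])
    ((fun y : V => y ord0 j) @^-1` A j)); last first.
  by apply/seteqP; split => y /= h j; [move=> _; exact: h|exact: h].
apply: fin_bigcap_measurable => // j _.
by rewrite -[X in measurable X]setTI; exact: measurable_coord_rV.
Qed.

Definition rat_box (q : {ffun 'I_n -> rat}) (k : nat) : set V :=
  [set x | forall i, ball (ratr (q i) : R) k.+1%:R^-1 (x ord0 i)].

Lemma measurable_rat_box q k : measurable (rat_box q k).
Proof.
apply: (@measurable_box (fun i => ball (ratr (q i) : R) k.+1%:R^-1)) => i.
by apply: open_measurable; exact: ball_open.
Qed.

(** The rational cubes form a countable base. *)
Lemma open_measurable_rV Om : open Om -> measurable Om.
Proof.
move=> oOm.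
pose G (m : nat) : set V :=
  if unpickle m is Some (q, k) then
    if `[< rat_box q k `<=` Om >] then rat_box q k else set0
  else set0.
rewrite (_ : Om = \bigcup_m G m).
  apply: bigcup_measurable => m _; rewrite /G.
  case: (unpickle m) => [[q k]|]; last exact: measurable0.
  by case: ifPn => _; [exact: measurable_rat_box|exact: measurable0].
apply/seteqP; split => [x Omx|x [m _]]; last first.
  rewrite /G; case: (unpickle m) => [[q k]|//].
  by case: ifPn => // /asboolP; apply.
have /nbhs_ballP[d /= d0 Hd] : nbhs x Om by exact: open_nbhs_nbhs.
have [k kd] : exists k : nat, k.+1%:R^-1 < d / 2.
  have /ltr_add_invr[k] : 0 < d / 2 by rewrite divr_gt0.
  by rewrite add0r => ?; exists k.
have k0 : 0 < k.+1%:R^-1 :> R by rewrite invr_gt0.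
have /choice[q Hq] : forall i, exists q : rat, `|ratr q - x ord0 i| < k.+1%:R^-1 :> R.
  move=> i.
  have /rat_in_itvoo[q] : x ord0 i - k.+1%:R^-1 < x ord0 i + k.+1%:R^-1.
    by rewrite ltrD2l gtrN.
  by rewrite in_itv /= => qI; exists q; rewrite ltr_distl.
pose q' := [ffun i => q i].
have sub : rat_box q' k `<=` Om.
  move=> y Hy; apply: Hd; apply: ball_rVP => // i.
  have := Hy i; rewrite -ball_normE /= ffunE => yi.
  have := Hq i; rewrite distrC => xi.
  rewrite (_ : _ - _ = (x ord0 i - ratr (q i)) + (ratr (q i) - y ord0 i)); last by ring.
  apply: (le_lt_trans (ler_normD _ _)); rewrite [ltRHS]splitr.
  by apply: ltrD; [exact: lt_trans xi kd|exact: lt_trans yi kd].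
exists (pickle (q', k)) => //; rewrite /G pickleK.
rewrite asboolT// => i; rewrite -ball_normE /= ffunE; exact: Hq.
Qed.

Lemma continuous_measurable_fun_rV Om f : open Om ->
  (forall x, Om x -> {for x, continuous f}) -> measurable_fun Om f.
Proof.
move=> oOm cf; apply: (measurability _ (RGenOpens.measurableE R)).
move=> _ [_ [a [b ->] <-]]; apply: open_measurable_rV.
rewrite openE => x [Omx fx].
have : nbhs x Om by exact: open_nbhs_nbhs.
have : nbhs x (f @^-1` [set` `]a, b[%R]).
  by apply: (cf x Omx); apply: open_nbhs_nbhs; split => //; exact: interval_open.
by move=> h1 h2; apply: filterS2 h1 h2 => y.
Qed.

Local Notation mu := (@lebesgue_rV R n).

Definition cube (M : R) : set V := [set x | forall i, `[- M, M]%classic (x ord0 i)].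

Lemma measurable_cube M : measurable (cube M).
Proof. exact: (@measurable_box (fun=> `[- M, M]%classic)). Qed.

Lemma cube_finite M : (mu (cube M) < +oo)%E.
Proof.
rewrite (@lebesgue_rV_box R n (fun=> `[- M, M]%classic))//.
rewrite (_ : (\prod_(i < n) _)%E = (\prod_(i < n) (fine (lebesgue_measure `[- M, M]%classic)))%:E).
  exact: ltry.
rewrite -prodEFin; apply: eq_bigr => i _; rewrite fineK//.
by rewrite lebesgue_measure_itv /=; case: ifP => //.
Qed.

Lemma bounded_set_sub_cube A : bounded_set A ->
  exists2 M : R, 0 < M & A `<=` cube M.
Proof.
move=> [M [_ HM]]; exists (`|M| + 1); first by rewrite ltr_wpDl.
move=> x Ax i; rewrite /= in_itv /= -ler_norml.
apply: le_trans (coord_le_norm x i) _; apply: HM => //.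
by rewrite (le_lt_trans (ler_norm M))// ltrDl.
Qed.

Lemma bounded_set_finite A : measurable A -> bounded_set A -> (mu A < +oo)%E.
Proof.
move=> mA /bounded_set_sub_cube[M _ AM].
apply: le_lt_trans (cube_finite M); apply: le_measure => //.
  by rewrite inE.
by rewrite inE; exact: measurable_cube.
Qed.

End measurability_rV.

Lemma bounded_support_integrable d (T : measurableType d) (R : realType)
    (mu : {measure set T -> \bar R}) (A : set T) (f : T -> R) (B : R) :
  measurable A -> (mu A < +oo)%E -> measurable_fun [set: T] f ->
  (forall x, `|f x| <= B) -> (forall x, ~ A x -> f x = 0) ->
  mu.-integrable [set: T] (EFin \o f).
Proof.
move=> mA Afin mf fB f0.
rewrite (_ : EFin \o f = (EFin \o f) \_ A); last first.
  apply/funext => x; rewrite patchE; case: ifPn => //= /negP xA.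
  by rewrite f0// => Ax; apply: xA; rewrite inE.
apply/(integrable_mkcond _ mA).
apply: measurable_bounded_integrable => //; first exact: measurable_funTS.
exists B; split; first exact: num_real.
by move=> M BM x _; apply: le_trans (fB x) (ltW BM).
Qed.

Section integration_by_parts_rV.
Context {R : realType}.
Local Notation e i := (delta_mx ord0 i : 'rV[R]_ _).

Lemma integral_eq_support d (T : measurableType d) (mu : {measure set T -> \bar R})
    (D : set T) (f : T -> \bar R) : (forall x, ~ D x -> f x = 0%E) ->
  (\int[mu]_x f x = \int[mu]_(x in D) f x)%E.
Proof.
move=> f0; rewrite [RHS]integral_mkcond; congr (integral _ _ _).
apply/funext => x; rewrite patchE; case: ifPn => // /negP xD.
by rewrite f0// => Dx; apply: xD; rewrite inE.
Qed.

Lemma integral_derive_eq0 (g dg : R -> R) (M : R) : (0 < M)%R ->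
  (forall t : R, is_derive t (1 : R) g (dg t)) -> continuous dg ->
  (forall t, (M <= `|t|)%R -> g t = 0%R /\ dg t = 0%R) ->
  (\int[lebesgue_measure]_t (dg t)%:E = 0)%E.
Proof.
move=> M0 Dg cdg g0.
rewrite (@integral_eq_support _ _ (@lebesgue_measure R) `[- M, M]%classic); last first.
  move=> t /= tM; rewrite (g0 t _).2// leNgt; apply/negP => tM'; apply: tM.
  by rewrite in_itv /= -ler_norml ltW.
have dg' t : derivable g t 1 by case: (Dg t).
have cg : continuous g.
  by move=> t; apply/differentiable_continuous/derivable1_diffP.
have gM : g M = 0 by apply: (g0 M _).1; rewrite ger0_norm// ltW.
have gNM : g (- M) = 0 by apply: (g0 _ _).1; rewrite normrN ger0_norm// ltW.
rewrite (@continuous_FTC2 R dg g (- M) M).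
- by rewrite gM gNM -EFinB subrr.
- by rewrite (@lt_trans _ _ 0%R)// oppr_lt0.
- exact: continuous_subspaceT.
- split.
  + by move=> t _; exact: dg'.
  + exact: cvg_at_right_filter (cg _).
  + exact: cvg_at_left_filter (cg _).
- by move=> t _; rewrite derive1E derive_val.
Qed.

Lemma cons_rV_line0 n (a t : R) (y : 'rV[R]_n) :
  cons_rV (a, y) + t *: e ord0 = cons_rV (a + t, y)%R.
Proof.
apply/rowP => k; rewrite !mxE eqxx /=.
by case: (unliftP ord0 k) => [j ->|->] /=; rewrite ?mulr0 ?addr0 ?mulr1.
Qed.

Lemma cons_rV_lineS n (a t : R) (y : 'rV[R]_n) j :
  cons_rV (a, y) + t *: e (lift ord0 j) = cons_rV (a, y + t *: e j)%R.
Proof.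
apply/rowP => k; rewrite !mxE eqxx /=.
case: (unliftP ord0 k) => [l ->|->] /=; rewrite ?mxE ?eqxx ?(inj_eq lift_inj)//.
by rewrite mulr0 addr0.
Qed.

Lemma is_derive_cons0 n (g : 'rV[R]_n.+1 -> R) (y : 'rV[R]_n) (t : R) :
  derivable g (cons_rV (t, y)) (e ord0) ->
  is_derive t 1%R (fun a : R => g (cons_rV (a, y))) (partial ord0 g (cons_rV (t, y))).
Proof.
move=> dg.
have := @is_derive_line R _ g (cons_rV (0%R, y)) (e ord0) t.
rewrite cons_rV_line0 add0r => /(_ dg).
by under eq_fun do rewrite cons_rV_line0 add0r.
Qed.

Lemma growth_rate_cons n (g : 'rV[R]_n.+1 -> R) a (y : 'rV[R]_n) j :
  (fun h : R => h^-1 *: (((fun z : 'rV[R]_n => g (cons_rV (a, z))) \o shift y) (h *: e j)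
     - g (cons_rV (a, y)))) =
  (fun h : R => h^-1 *: ((g \o shift (cons_rV (a, y))) (h *: e (lift ord0 j))
     - g (cons_rV (a, y)))).
Proof.
by apply/funext => h /=; rewrite (addrC (h *: e (lift _ _))) cons_rV_lineS (addrC y).
Qed.

Lemma partial_cons n (g : 'rV[R]_n.+1 -> R) a (y : 'rV[R]_n) j :
  partial j (fun z => g (cons_rV (a, z))) y = partial (lift ord0 j) g (cons_rV (a, y)).
Proof. by rewrite /partial /derive growth_rate_cons. Qed.

Lemma derivable_cons n (g : 'rV[R]_n.+1 -> R) a (y : 'rV[R]_n) j :
  derivable g (cons_rV (a, y)) (e (lift ord0 j)) ->
  derivable (fun z => g (cons_rV (a, z))) y (e j).
Proof. by rewrite /derivable growth_rate_cons. Qed.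

(** If the variable of differentiation is the first one, it is integrated first
    and the fundamental theorem of calculus applies; otherwise the first
    variable is integrated last and the inner integral is that of one dimension
    less. *)
Lemma integral_partial_eq0T n (g : 'rV[R]_n -> R) (i : 'I_n) (M B : R) : (0 < M)%R ->
  (forall x, derivable g x (e i)) ->
  (forall x, continuous (fun t : R => partial i g (x + t *: e i))) ->
  measurable_fun [set: 'rV[R]_n] (partial i g) ->
  (forall x, `|partial i g x| <= B)%R ->
  (forall x : 'rV[R]_n, (exists j, M <= `|x ord0 j|)%R -> g x = 0%R /\ partial i g x = 0%R) ->
  (\int[lebesgue_rV n]_x (partial i g x)%:E = 0)%E.
Proof.
move=> M0; elim: n => [|n ih] in g i *; first by case: i.
move=> dg cg mg gB g0.
pose f := partial i g.
pose C := cube M : set 'rV[R]_n.+1.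
have mC : measurable C by exact: measurable_cube.
have mcons := @measurable_cons_rV R n.
have mfc : measurable_fun [set: measurableTypeR R * 'rV[R]_n] (f \o @cons_rV R n).
  exact: measurableT_comp.
have mCc : measurable (@cons_rV R n @^-1` C).
  by rewrite -[X in measurable X]setTI; exact: mcons.
have f0 x : ~ C x -> f x = 0%R.
  move=> /existsNP[j]; rewrite /= in_itv /= -ler_norml => /negP; rewrite -ltNge => /ltW xj.
  by apply: (g0 x _).2; exists j.
have ifc : (lebesgue_measure \x lebesgue_rV n)%E.-integrable setT
    (EFin \o (f \o @cons_rV R n)).
  apply: (@bounded_support_integrable _ _ _ _ (@cons_rV R n @^-1` C) _ B) => //.
  - exact: (@cube_finite R n.+1 M).
  - by move=> p; exact: gB.
  - by move=> p; exact: f0.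
transitivity (\int[pushforward (lebesgue_measure \x lebesgue_rV n)%E (@cons_rV R n)]_x
    (EFin \o f) x)%E; first by [].
rewrite integral_pushforward//=; last exact/measurable_EFinP.
rewrite preimage_setT.
case: (unliftP ord0 i) => [j ij|i0].
- rewrite -(integral12_prod_meas1 ifc).
  rewrite -[RHS](@integral0 _ _ _ lebesgue_measure setT).
  apply: eq_integral => a _ /=.
  have <- : (\int[lebesgue_rV n]_y (partial j (fun z => g (cons_rV (a, z))) y)%:E = 0)%E.
    apply: ih.
    + by move=> y; apply: derivable_cons; rewrite -ij.
    + move=> y; have := cg (cons_rV (a, y)); rewrite ij.
      by under eq_fun do rewrite cons_rV_lineS -partial_cons.
    + rewrite (_ : partial j _ = (f \o @cons_rV R n) \o pair (a : measurableTypeR R)).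
        exact: measurableT_comp.
      by apply/funext => y; rewrite partial_cons -ij.
    + by move=> y; rewrite partial_cons -ij.
    + move=> y [k yk]; rewrite partial_cons -ij.
      by apply: g0; exists (lift ord0 k); rewrite mxE liftK.
  by apply: eq_integral => y _; rewrite partial_cons -ij.
- rewrite -(integral21_prod_meas1 ifc).
  rewrite -[RHS](@integral0 _ _ _ (lebesgue_rV n) setT).
  apply: eq_integral => y _ /=.
  apply: (@integral_derive_eq0 (fun a : R => g (cons_rV (a, y))) _ M) => //.
  + by move=> t; rewrite /f i0; apply: is_derive_cons0; rewrite -i0.
  + have := cg (cons_rV (0%R, y)); rewrite /f i0.
    by under eq_fun do rewrite cons_rV_line0 add0r.
  + move=> t tM; apply: g0; exists ord0.
    by rewrite mxE unlift_none.
Qed.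

(** [f] is replaced by its extension by 0 outside [K], which is differentiable on
    the whole space because [Om] and the complement of [K] cover it. *)
Lemma integral_partial_eq0 n (Om K : set 'rV[R]_n) (f : 'rV[R]_n -> R) (i : 'I_n) :
  open Om -> compact K -> K `<=` Om -> (forall x, Om x -> ~ K x -> f x = 0%R) ->
  (forall x, Om x -> derivable f x (e i)) ->
  (forall x, Om x -> {for x, continuous (partial i f)}) ->
  (\int[lebesgue_rV n]_(x in Om) (partial i f x)%:E = 0)%E.
Proof.
move=> oOm cK KOm f0 df cf.
have clK : closed K by exact: compact_closed.
have oKC : open (~` K) by exact: closed_openC.
pose g : 'rV[R]_n -> R := f \_ K.
have gf : {in Om, f =1 g}.
  move=> x; rewrite inE => Omx; rewrite /g patchE; case: ifPn => // /negP.
  by rewrite inE => /f0 ->.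
have g00 : {in ~` K, (fun=> 0%R) =1 g}.
  by move=> x; rewrite inE => nKx; rewrite /g patchE memNset.
have cover x : Om x \/ (~` K) x.
  by have [Kx|nKx] := pselect (K x); [left; exact: KOm|right].
have pgf : {in Om, partial i f =1 partial i g}.
  by move=> x; rewrite inE => Omx; apply: near_eq_derive; exact: open_near_eq gf.
have pg0 : {in ~` K, (fun=> 0%R) =1 partial i g}.
  move=> x; rewrite inE => nKx; rewrite /partial.
  by rewrite -(near_eq_derive _ (open_near_eq oKC nKx g00)) derive_cst.
have dg x : derivable g x (e i).
  have [Omx|nKx] := cover x.
    exact: near_eq_derivable (open_near_eq oOm Omx gf) (df x Omx).
  exact: near_eq_derivable (open_near_eq oKC nKx g00) (derivable_cst _ _ _).
have cg : continuous (partial i g).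
  move=> x; have [Omx|nKx] := cover x.
    exact: near_eq_continuous (open_near_eq oOm Omx pgf) (cf x Omx).
  apply: near_eq_continuous (open_near_eq oKC nKx pg0) _; exact: cst_continuous.
have [M M0 KM] : exists2 M : R, (0 < M)%R & K `<=` cube M.
  exact/bounded_set_sub_cube/compact_bounded.
have [B HB] : exists B : R, forall x, (`|partial i g x| <= B)%R.
  have cn : continuous (fun x => `|partial i g x|%R).
    by move=> x; apply: continuous_comp (cg x) _; exact: norm_continuous.
  have [K0|K0] := eqVneq K set0.
    exists 0%R => x; rewrite -pg0 ?normr0// inE K0 => h; exact: h.
  have /set0P K0' := K0.
  have [c _ Hc] := EVT_max_rV K0' cK (continuous_subspaceT cn).
  exists `|partial i g c|%R => x; have [Kx|nKx] := pselect (K x).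
    by apply: Hc; rewrite inE.
  by rewrite -pg0 ?inE// normr0.
have KT (x : 'rV[R]_n) : (exists j, M + 1 <= `|x ord0 j|)%R -> (~` K) x.
  move=> [j xj] /KM /(_ j) /=; rewrite in_itv /= -ler_norml => xM.
  by have := le_trans xj xM; rewrite gerDl ler10.
have <- : (\int[lebesgue_rV n]_x (partial i g x)%:E = 0)%E.
  apply: (@integral_partial_eq0T n g i (M + 1) B).
  - by rewrite addr_gt0.
  - exact: dg.
  - move=> x t; apply: (@continuous_comp _ _ _ (fun t : R => x + t *: e i) (partial i g)).
      by apply: cvgD; [exact: cvg_cst|apply: cvgZr_tmp; exact: cvg_id].
    exact: cg.
  - apply: continuous_measurable_fun_rV; first exact: openT.
    by move=> x _; exact: cg.
  - exact: HB.
  - by move=> x /KT nKx; rewrite -pg0 -?g00 ?inE.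
rewrite (@integral_eq_support _ _ (lebesgue_rV n) Om); last first.
  by move=> x nOm; rewrite -pg0// inE => Kx; exact/nOm/KOm.
by apply: eq_integral => x /pgf ->.
Qed.

End integration_by_parts_rV.

(** * Convexity of the solution *)

Section convexity.
Context {R : realType} (n : nat).
Local Notation V := 'rV[R]_n.
Implicit Types (Om : set V) (f w : V -> R) (x y : V).

Lemma laplacian_tr w x : laplacian w x = \tr (hessian w x).
Proof. by apply: eq_bigr => i _; rewrite mxE. Qed.

Lemma bounded_closure Om : bounded_set Om -> bounded_set (closure Om).
Proof.
move=> [M [_ HM]]; exists (`|M| + 2); split; first exact: num_real.
move=> N MN x clx.
have [y [Omy]] := clx _ (nbhsx_ballx x 1 ltr01).
rewrite -ball_normE /= => xy.
have yM : `|y| <= `|M| + 1.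
  by apply: HM => //; rewrite (le_lt_trans (ler_norm M))// ltrDl.
rewrite -(subrK y x); apply: (le_trans (ler_normD _ _)).
by apply/ltW; apply: le_lt_trans MN; lra.
Qed.

Lemma compact_closure_bounded Om : bounded_set Om -> compact (closure Om).
Proof.
by move=> /bounded_closure bOm; apply: bounded_closed_compact => //; exact: closed_closure.
Qed.

Lemma bdryP Om x : open Om -> closure Om x -> Om x \/ bdry Om x.
Proof.
move=> oOm clx; have [Omx|nOmx] := pselect (Om x); [by left|right].
by split=> // /interior_subset.
Qed.

Lemma continuous_bil_hessian Om w v x : open Om -> Ck 2 Om w -> Om x ->
  {for x, continuous (fun y => bil (hessian w y) v v)}.
Proof.
move=> oOm Cw Omx.
apply: (@Ck_continuous R n 0 Om _ x _ Omx).
under eq_fun do rewrite bilE.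
apply: (Ck_sum _ _ oOm) => i; apply: (Ck_sum _ _ oOm) => j.
apply: (CkM oOm); first exact: Ck_cst.
exact: Ck_hessian.
Qed.

Lemma continuous_tr_hessian Om w x : open Om -> Ck 2 Om w -> Om x ->
  {for x, continuous (fun y => \tr (hessian w y))}.
Proof.
move=> oOm Cw Omx.
apply: (@Ck_continuous R n 0 Om _ x _ Omx).
by apply: (Ck_sum _ _ oOm) => i; exact: Ck_hessian.
Qed.

(** Where [w - c |x - x1|^2] is smallest the Hessian of [w] is at least [2 c];
    for small [c > 0] that point is not on the boundary. *)
Lemma exists_convex_point Om w : (0 < n)%N -> open Om -> bounded_set Om -> Ck 2 Om w ->
  {within closure Om, continuous w} ->
  (forall x, bdry Om x -> w x = 0) -> (forall x, Om x -> w x <= 0) ->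
  (exists2 x, Om x & w x != 0) ->
  exists2 x, Om x & psd (hessian w x) /\ 0 < \tr (hessian w x).
Proof.
move=> n0 oOm bOm Cw cw w0 wle [x1 Omx1 wx1].
have wx1lt : w x1 < 0 by rewrite lt_neqAle wx1 wle.
have cK := compact_closure_bounded bOm.
have K0 : closure Om !=set0 by exists x1; exact: subset_closure.
have cq : continuous (sqdist x1).
  by move=> x; apply: (Ck_continuous (@Ck_sqdist R n 0 setT x1 openT)).
have [y1 _ Hy1] := EVT_max_rV K0 cK (continuous_subspaceT cq).
set C := sqdist x1 y1.
have C0 : 0 <= C by apply: sumr_ge0 => i _; rewrite sqr_ge0.
have C1 : 0 < C + 1 by rewrite ltr_wpDl.
pose c := - w x1 / (C + 1).
have c0 : 0 < c by rewrite divr_gt0// oppr_gt0.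
have ch : {within closure Om, continuous (fun y => w y - c * sqdist x1 y)}.
  have cq' : continuous (fun y => c * sqdist x1 y).
    move=> x; apply: (@Ck_continuous R n 0 setT _ x _ I).
    by apply: (CkM openT); [exact: Ck_cst|exact: Ck_sqdist openT].
  by move=> x; apply: cvgB; [exact: cw|exact: continuous_subspaceT cq' x].
have [x clx Hx] := EVT_min_rV K0 cK ch.
have clx1 : x1 \in closure Om by rewrite inE; exact: subset_closure.
have qx1 : sqdist x1 x1 = 0 by apply: big1 => i _; rewrite subrr expr0n.
have Omx : Om x.
  have [//|bx] : Om x \/ bdry Om x by apply: bdryP => //; rewrite inE in clx.
  exfalso; have := Hx _ clx1; rewrite qx1 mulr0 subr0 w0// sub0r; apply/negP.
  rewrite -ltNge -[ltLHS]opprK ltrN2.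
  apply: (@le_lt_trans _ _ (c * C)); first by rewrite ler_pM2l// Hy1.
  by rewrite /c mulrAC ltr_pdivrMr// ltr_pM2l ?oppr_gt0// ltrDl.
have H (v : V) : 2 * c * \sum_i v ord0 i ^+ 2 <= bil (hessian w x) v v.
  apply: (@hessian_ge_at_min_sub_sqdist R n Om w x1 x v c oOm Cw Omx) => y Omy.
  by apply: Hx; rewrite inE; exact: subset_closure.
exists x => //; split.
  split; first exact: hessian_sym Omx.
  move=> v; apply: le_trans (H v); apply: mulr_ge0; first by rewrite mulr_ge0// ltW.
  by apply: sumr_ge0 => i _; rewrite sqr_ge0.
have d0 i : 2 * c <= hessian w x i i.
  rewrite -(bil_delta (hessian w x)); apply: le_trans (H _).
  rewrite (bigD1 i)//= big1 ?addr0; last first.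
    by move=> j ji; rewrite mxE (negbTE ji) andbF expr0n.
  by rewrite mxE !eqxx expr1n mulr1.
apply: (@lt_le_trans _ _ (\sum_(i < n) 2 * c)); last exact: ler_sum.
by rewrite sumr_const card_ord pmulrn_lgt0// mulr_gt0.
Qed.

(** The set where the Hessian is nonnegative and nonzero is open because
    there [det = tr > 0] makes it definite, and closed because [0] is isolated
    among the nonnegative solutions of [det = tr]. *)
Lemma hessian_psd_on Om w : (2 <= n)%N -> open Om -> connected Om -> bounded_set Om ->
  Ck 2 Om w -> {within closure Om, continuous w} ->
  (forall x, Om x -> \det (hessian w x) = \tr (hessian w x)) ->
  (forall x, bdry Om x -> w x = 0) -> (forall x, Om x -> w x <= 0) ->
  (exists2 x, Om x & w x != 0) ->
  forall x, Om x -> psd (hessian w x) /\ 0 < \tr (hessian w x).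
Proof.
move=> n2 oOm conOm bOm Cw cw weq w0 wle wnz.
have n0 : (0 < n)%N by exact: leq_trans n2.
pose S : set V := [set x | Om x /\ (psd (hessian w x) /\ 0 < \tr (hessian w x))].
suff SOm : S = Om by move=> x; rewrite -{1}SOm => -[].
apply: conOm.
- have [x Omx Hx] := exists_convex_point n0 oOm bOm Cw cw w0 wle wnz.
  by exists x.
- exists S; last by apply/seteqP; split=> x // -[].
  rewrite openE => x [Omx [px trx]].
  have ux : hessian w x \in unitmx by rewrite unitmxE weq// unitfE gt_eqF.
  have [c c0 Hc] := psd_unit_coercive px ux.
  have cn0 : 0 < c / n%:R by rewrite divr_gt0// ltr0n.
  have near_ij (i j : 'I_n) : \forall y \near x,
      `|hessian w y i j - hessian w x i j| <= c / n%:R.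
    have : {for x, continuous (fun y => hessian w y i j)}.
      exact: Ck_continuous (Ck_hessian i j Cw) Omx.
    by move=> /cvgrPdistC_le /(_ _ cn0).
  have near_i (i : 'I_n) : \forall y \near x, forall j : 'I_n,
      `|hessian w y i j - hessian w x i j| <= c / n%:R.
    exact: (@filter_forall _ 'I_n _ _ (nbhs_filter x) (near_ij i)).
  have near_entry : \forall y \near x, forall i j : 'I_n,
      `|hessian w y i j - hessian w x i j| <= c / n%:R.
    exact: (@filter_forall _ 'I_n _ _ (nbhs_filter x) near_i).
  have near_tr : \forall y \near x, 0 < \tr (hessian w y).
    by have := continuous_tr_hessian oOm Cw Omx; move/cvgr_gt; exact.
  have near_Om : \forall y \near x, Om y by exact: open_nbhs_nbhs.
  near=> y.
  have Omy : Om y by near: y; exact: near_Om.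
  split; first exact: Omy.
  split; last by near: y; exact: near_tr.
  apply: (coercive_perturb _ Hc); first exact: hessian_sym Omy.
  by near: y; exact: near_entry.
- exists (closure S); first exact: closed_closure.
  apply/seteqP; split=> [x Sx|x [Omx clx]]; first by split; [case: Sx|exact: subset_closure].
  have tr_ge : n`!%:R^-1 <= \tr (hessian w x).
    rewrite leNgt; apply/negP => trlt.
    have : \forall y \near x, \tr (hessian w y) < n`!%:R^-1.
      by have := continuous_tr_hessian oOm Cw Omx; move/cvgr_lt; exact.
    move=> /clx[y [[Omy [py try]]]]; apply/negP; rewrite -leNgt.
    exact: psd_tr_isolated n2 py (weq y Omy) try.
  split; first exact: Omx.
  split; last first.
    by apply: lt_le_trans tr_ge; rewrite invr_gt0 ltr0n fact_gt0.
  split; first exact: hessian_sym Omx.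
  move=> v; rewrite leNgt; apply/negP => blt.
  have : \forall y \near x, bil (hessian w y) v v < 0.
    by have := @continuous_bil_hessian Om w v x oOm Cw Omx; move/cvgr_lt; exact.
  by move=> /clx[y [[Omy [py _]]]]; apply/negP; rewrite -leNgt; exact: py.2.
Unshelve. all: by end_near. Qed.

End convexity.

(** * Integrability and the density argument *)

Section integrable_functions.
Context {R : realType} (n : nat).
Local Notation V := 'rV[R]_n.
Local Notation mu := (@lebesgue_rV R n).
Context (Om : set V) (oOm : open Om).
Implicit Types (f g u v : V -> R) (x : V).

Local Notation L1 f := (mu.-integrable Om (EFin \o f)).
Local Notation L2 f := (square_integrable Om f).

Let mOm : measurable Om. Proof. exact: open_measurable_rV. Qed.

Lemma L1_le f g : measurable_fun Om f -> (forall x, Om x -> `|f x| <= g x) ->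
  L1 g -> L1 f.
Proof.
move=> mf fg; apply: le_integrable => //; first exact/measurable_EFinP.
move=> x Omx /=; rewrite lee_fin; apply: le_trans (ler_norm _); exact: fg.
Qed.

Lemma L1D f g : L1 f -> L1 g -> L1 (fun x => f x + g x).
Proof. by move=> If Ig; exact: (integrableD mOm If Ig). Qed.

Lemma L1Z (c : R) f : L1 f -> L1 (fun x => c * f x).
Proof. by move=> If; exact: (integrableZl mOm c If). Qed.

Lemma L1_sum (I : Type) (r : seq I) (F : I -> V -> R) :
  (forall i, L1 (F i)) -> L1 (fun x => \sum_(i <- r) F i x).
Proof.
move=> IF; elim: r => [|a r ih].
  rewrite (_ : EFin \o _ = cst 0%E); first exact: integrable0.
  by apply/funext => x /=; rewrite big_nil.
rewrite (_ : EFin \o _ = EFin \o (fun x => F a x + \sum_(i <- r) F i x)).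
  exact: L1D.
by apply/funext => x /=; rewrite big_cons.
Qed.

Lemma Rintegral_sum (I : Type) (r : seq I) (F : I -> V -> R) :
  (forall i, L1 (F i)) ->
  \int[mu]_(x in Om) (\sum_(i <- r) F i x) = \sum_(i <- r) \int[mu]_(x in Om) F i x.
Proof.
move=> IF; elim: r => [|a r ih].
  rewrite big_nil; under eq_Rintegral do rewrite big_nil.
  by rewrite Rintegral_cst// mul0r.
rewrite big_cons -ih -RintegralD//; last exact: L1_sum.
by apply: eq_Rintegral => x _; rewrite big_cons.
Qed.

Lemma L2_measurable u : L2 u -> measurable_fun Om u.
Proof. by case. Qed.

Lemma L2_L1 u : L2 u -> L1 (fun x => u x ^+ 2).
Proof. by case. Qed.

Lemma L2M u v : L2 u -> L2 v -> L1 (fun x => u x * v x).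
Proof.
move=> [mu_ iu] [mv iv].
apply: (@L1_le _ (fun x => u x ^+ 2 + v x ^+ 2)); last exact: L1D iu iv.
  exact: measurable_funM.
move=> x _; rewrite ler_norml; apply/andP; split.
  have := sqr_ge0 (u x + v x); have := sqr_ge0 (u x); have := sqr_ge0 (v x); lra.
have := sqr_ge0 (u x - v x); have := sqr_ge0 (u x); have := sqr_ge0 (v x); lra.
Qed.

Lemma L2D u v : L2 u -> L2 v -> L2 (fun x => u x + v x).
Proof.
move=> Lu Lv; split; first exact: measurable_funD (L2_measurable Lu) (L2_measurable Lv).
apply: (@L1_le _ (fun x => (u x ^+ 2 + v x ^+ 2) + 2 * (u x * v x))).
- apply: measurable_funX.
  exact: measurable_funD (L2_measurable Lu) (L2_measurable Lv).
- by move=> x _; rewrite ger0_norm ?sqr_ge0//; lra.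
- apply: L1D; first exact: L1D (L2_L1 Lu) (L2_L1 Lv).
  exact/L1Z/L2M.
Qed.

Lemma L2B u v : L2 u -> L2 v -> L2 (fun x => u x - v x).
Proof.
move=> Lu Lv; apply: (L2D Lu); split; first exact: measurable_funN (L2_measurable Lv).
by rewrite (_ : (fun x => _) = (fun x => (v x ^+ 2)%:E)) ?Lv.2//;
  apply/funext => x; rewrite sqrrN.
Qed.

Definition cbounded f := (forall x, Om x -> {for x, continuous f}) /\
  exists B : R, forall x, Om x -> `|f x| <= B.

Lemma cbounded_cst (c : R) : cbounded (fun=> c).
Proof. by split; [move=> x _; exact: cst_continuous|exists `|c|]. Qed.

Lemma cboundedD f g : cbounded f -> cbounded g -> cbounded (fun x => f x + g x).
Proof.
move=> [cf [B fB]] [cg [C gC]]; split.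
  by move=> x Omx; exact: cvgD (cf x Omx) (cg x Omx).
exists (B + C) => x Omx; apply: (le_trans (ler_normD _ _)).
by rewrite lerD ?fB ?gC.
Qed.

Lemma cboundedM f g : cbounded f -> cbounded g -> cbounded (fun x => f x * g x).
Proof.
move=> [cf [B fB]] [cg [C gC]]; split.
  by move=> x Omx; exact: cvgM (cf x Omx) (cg x Omx).
exists (B * C) => x Omx; rewrite normrM.
by rewrite ler_pM ?fB ?gC.
Qed.

Lemma cbounded_sum (I : Type) (r : seq I) (P : pred I) (F : I -> V -> R) :
  (forall i, cbounded (F i)) -> cbounded (fun x => \sum_(i <- r | P i) F i x).
Proof.
move=> CF; elim: r => [|a r ih].
  by under eq_fun do rewrite big_nil; exact: cbounded_cst.
under eq_fun do rewrite big_cons.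
by case: (P a); [exact: cboundedD (CF a) ih|exact: ih].
Qed.

Lemma cbounded_prod (I : Type) (r : seq I) (P : pred I) (F : I -> V -> R) :
  (forall i, cbounded (F i)) -> cbounded (fun x => \prod_(i <- r | P i) F i x).
Proof.
move=> CF; elim: r => [|a r ih].
  by under eq_fun do rewrite big_nil; exact: cbounded_cst.
under eq_fun do rewrite big_cons.
by case: (P a); [exact: cboundedM (CF a) ih|exact: ih].
Qed.

Lemma cbounded_measurable f : cbounded f -> measurable_fun Om f.
Proof. by move=> [cf _]; exact: continuous_measurable_fun_rV. Qed.

Lemma cbounded_eq f g : {in Om, f =1 g} -> cbounded f -> cbounded g.
Proof.
move=> fg [cf [B fB]]; split.
  by move=> x Omx; exact: near_eq_continuous (open_near_eq oOm Omx fg) (cf x Omx).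
by exists B => x Omx; rewrite -fg ?inE//; exact: fB.
Qed.

Lemma cbounded_compact_support f (K : set V) : compact K -> K `<=` Om ->
  (forall x, Om x -> {for x, continuous f}) ->
  (forall x, Om x -> ~ K x -> f x = 0) -> cbounded f.
Proof.
move=> cK KOm cf f0; split=> //.
have [K0|/set0P K0] := eqVneq K set0.
  by exists 0 => x Omx; rewrite f0 ?normr0// K0.
have ck : {within K, continuous (fun x => `|f x|)}.
  apply/continuous_in_subspaceT => x; rewrite inE => Kx.
  apply: (@continuous_comp _ _ _ f (fun r : R => `|r|)); first exact/cf/KOm.
  exact: norm_continuous.
have [c _ Hc] := EVT_max_rV K0 cK ck.
exists `|f c| => x Omx; have [Kx|nKx] := pselect (K x).
  by apply: Hc; rewrite inE.
by rewrite f0 ?normr0.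
Qed.

Context (fOm : (mu Om < +oo)%E).

Lemma cbounded_L1 f : cbounded f -> L1 f.
Proof.
move=> Cf; have [_ [B fB]] := Cf.
apply: measurable_bounded_integrable => //; first exact: cbounded_measurable.
exists B; split; first exact: num_real.
by move=> M BM x Omx; apply: le_trans (fB x Omx) (ltW BM).
Qed.

Lemma cbounded_L2 f : cbounded f -> L2 f.
Proof.
move=> Cf; split; first exact: cbounded_measurable.
apply: (@cbounded_L1 (fun x => f x ^+ 2)).
by under eq_fun do rewrite expr2; exact: cboundedM.
Qed.

Lemma L2_cboundedM f u : cbounded f -> L2 u -> L2 (fun x => f x * u x).
Proof.
move=> Cf Lu; have mf := cbounded_measurable Cf; have [_ [B fB]] := Cf.
have mfu : measurable_fun Om (fun x => f x * u x).
  exact: measurable_funM mf (L2_measurable Lu).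
split=> //; apply: (@L1_le _ (fun x => B ^+ 2 * u x ^+ 2)).
- exact: measurable_funX.
- move=> x Omx; rewrite ger0_norm ?sqr_ge0// exprMn ler_wpM2r ?sqr_ge0//.
  rewrite -(real_normK (num_real (f x))) ler_sqr ?nnegrE ?fB//.
  exact: le_trans (normr_ge0 _) (fB x Omx).
- exact/L1Z/L2_L1.
Qed.

Lemma integral_div_eq0 (K : set V) (F : 'I_n -> V -> R) :
  compact K -> K `<=` Om -> (forall i, Ck 1 Om (F i)) ->
  (forall i x, Om x -> ~ K x -> F i x = 0) ->
  \int[mu]_(x in Om) (\sum_(i < n) partial i (F i) x) = 0.
Proof.
move=> cK KOm CF F0.
have clK : open (~` K) by apply: closed_openC; exact: compact_closed.
have cp i x : Om x -> {for x, continuous (partial i (F i))}.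
  by move=> Omx; exact: Ck_continuous (Ck_partial i (CF i)) Omx.
have p0 i x : Om x -> ~ K x -> partial i (F i) x = 0.
  move=> Omx nKx.
  have E : {in Om `&` ~` K, F i =1 (fun=> 0)}.
    by move=> y; rewrite inE => -[Omy nKy]; exact: F0.
  have oOK : open (Om `&` ~` K) by exact: openI.
  by rewrite [LHS](near_eq_derive _ (open_near_eq oOK (conj Omx nKx) E)) derive_cst.
have IF i : L1 (partial i (F i)).
  by apply: cbounded_L1; exact: cbounded_compact_support cK KOm (cp i) (p0 i).
rewrite (Rintegral_sum _ IF) big1// => i _.
rewrite /Rintegral (@integral_partial_eq0 R n Om K (F i) i)//.
- exact: F0.
- by move=> x Omx; exact: Ck_derivable i (CF i) Omx.
- exact: cp.
Qed.

Lemma integral_flux_eq0 (K : set V) (F : 'I_n -> V -> R) (f : V -> R) :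
  compact K -> K `<=` Om -> (forall i, Ck 1 Om (F i)) -> Ck 1 Om f ->
  (forall x, Om x -> ~ K x -> f x = 0) ->
  \int[mu]_(x in Om) (\sum_(i < n) F i x * partial i f x
    + (\sum_(i < n) partial i (F i) x) * f x) = 0.
Proof.
move=> cK KOm CF Cf f0.
rewrite -[RHS](@integral_div_eq0 K (fun i x => F i x * f x) cK KOm).
- apply: eq_Rintegral => x; rewrite inE => Omx.
  rewrite /= mulr_suml -big_split /=; apply: eq_bigr => i _.
  rewrite partialM; first by rewrite [f x * _]mulrC.
    exact: Ck_derivable i (CF i) Omx.
  exact: Ck_derivable i Cf Omx.
- by move=> i; exact: (CkM oOm (CF i) Cf).
- by move=> i x Omx nKx; rewrite f0// mulr0.
Qed.

Lemma test_function_cbounded (phi : V -> R) : test_function Om phi -> cbounded phi.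
Proof.
move=> [Cphi csupp sOm]; apply: (cbounded_compact_support csupp sOm) => [x _|x _ nKx].
  exact: Ck_continuous (Cphi 0) I.
apply/eqP/negPn/negP => px; apply: nKx; exact: subset_closure.
Qed.

Lemma test_function_cbounded_partial (phi : V -> R) i : test_function Om phi ->
  cbounded (partial i phi).
Proof.
move=> [Cphi csupp sOm].
apply: (cbounded_compact_support csupp sOm) => [x _|x _ nKx].
  exact: Ck_continuous (Ck_partial i (Cphi 1)) I.
have oKC : open (~` closure [set x | phi x != 0]) by exact/closed_openC/closed_closure.
have E : {in ~` closure [set x | phi x != 0], phi =1 (fun=> 0)}.
  move=> y; rewrite inE => nKy.
  by apply/eqP/negPn/negP => px; apply: nKy; exact: subset_closure.
by rewrite [LHS](near_eq_derive _ (open_near_eq oKC nKx E)) derive_cst.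
Qed.

(** A bounded first-order functional is continuous for the [W^{1,2}] norm, by
    [|t| <= d + t^2 / d]; so it vanishes on [W^{1,2}_0] when it does on test
    functions. *)
Lemma W12_0_functional_eq0 (F : 'I_n -> V -> R) (G : V -> R) (u : V -> R)
    (Du : 'I_n -> V -> R) :
  (forall i, cbounded (F i)) -> cbounded G ->
  (forall phi, test_function Om phi ->
    \int[mu]_(x in Om) (\sum_(i < n) F i x * partial i phi x + G x * phi x) = 0) ->
  W12_0 Om u Du ->
  \int[mu]_(x in Om) (\sum_(i < n) F i x * Du i x + G x * u x) = 0.
Proof.
move=> CF CG Hphi [[Lu HDu] [phi tphi cvphi]].
have LDu i : L2 (Du i) by case: (HDu i).
have /choice[B HB] : forall i, exists B : R, forall x, Om x -> `|F i x| <= B.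
  by move=> i; case: (CF i).
have [_ [C HC]] := CG.
pose M := `|C| + \sum_(i < n) `|B i|.
have M0 : 0 <= M by rewrite addr_ge0// sumr_ge0.
have FM i x : Om x -> `|F i x| <= M.
  move=> Omx; apply: (le_trans (HB i x Omx)); apply: (le_trans (ler_norm _)).
  by rewrite /M (bigD1 i)//= addrCA lerDl addr_ge0// sumr_ge0.
have GM x : Om x -> `|G x| <= M.
  move=> Omx; apply: (le_trans (HC x Omx)); apply: (le_trans (ler_norm _)).
  by rewrite lerDl sumr_ge0.
have IF (v : V -> R) (Dv : 'I_n -> V -> R) : L2 v -> (forall i, L2 (Dv i)) ->
    L1 (fun x => \sum_(i < n) F i x * Dv i x + G x * v x).
  move=> Lv LDv; apply: L1D; last exact: L2M (cbounded_L2 CG) Lv.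
  by apply: L1_sum => i; exact: L2M (cbounded_L2 (CF i)) (LDv i).
set J := LHS.
pose m := fine (mu Om).
have m0 : 0 <= m by rewrite fine_ge0.
suff H (d : R) : 0 < d -> `|J| <= M * (n.+1%:R * m + 1) * d.
  apply/eqP; rewrite -normr_le0; apply/ler_addgt0Pr => eps eps0; rewrite add0r.
  set c := M * _ in H.
  have c0 : 0 <= c by rewrite mulr_ge0// addr_ge0// mulr_ge0.
  have c1 : 0 < c + 1 by rewrite ltr_wpDl.
  have := H (eps / (c + 1)); rewrite divr_gt0// => /(_ isT) /le_trans; apply.
  by rewrite mulrCA ler_piMr ?ltW// ltr_pdivrMr// mul1r ltrDl.
move=> d0.
pose T k x := (phi k x - u x) ^+ 2 + \sum_(i < n) (partial i (phi k) x - Du i x) ^+ 2.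
have Lphi k : L2 (phi k).
  exact/cbounded_L2/test_function_cbounded.
have LDphi k i : L2 (partial i (phi k)).
  exact/cbounded_L2/test_function_cbounded_partial.
have Lv k : L2 (fun x => phi k x - u x).
  exact: L2B.
have LDv k i : L2 (fun x => partial i (phi k) x - Du i x).
  exact: L2B.
have LT k : L1 (T k).
  apply: L1D; first exact: L2_L1 (Lv k).
  by apply: L1_sum => i; exact: L2_L1 (LDv k i).
have [k Hk] : exists k, \int[mu]_(x in Om) T k x < d ^+ 2.
  have : nbhs (0%E : \bar R) [set y | (y < (d ^+ 2)%:E)%E].
    apply: open_nbhs_nbhs; split; first exact: open_ereal_lt_ereal.
    by rewrite /= lte_fin exprn_gt0.
  move=> /cvphi [N _ /(_ N (leqnn N)) /= HN]; exists N.
  rewrite -lte_fin /Rintegral fineK//; exact: integrable_fin_num (LT N).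
pose Err x := \sum_(i < n) F i x * (partial i (phi k) x - Du i x) + G x * (phi k x - u x).
have LErr : L1 Err by exact: IF.
have J_eq : J = - \int[mu]_(x in Om) Err x.
  apply/eqP; rewrite -addr_eq0 -RintegralD//; last exact: IF.
  rewrite -[X in _ == X](Hphi _ (tphi k)); apply/eqP/eq_Rintegral => x _.
  rewrite /Err addrACA -big_split /=; congr (_ + _); last by ring.
  by apply: eq_bigr => i _; ring.
have abs_le t : `|t| <= d + t ^+ 2 / d.
  rewrite -(ler_pM2r d0) mulrDl divfK ?gt_eqF// -(real_normK (num_real t)).
  have := sqr_ge0 (`|t| - d); have := mulr_ge0 (normr_ge0 t) (ltW d0); lra.
pose bound x := M * n.+1%:R * d + M / d * T k x.
have Lbound : L1 bound.
  by apply: L1D; [exact: cbounded_L1 (cbounded_cst _)|exact: L1Z].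
have Err_le x : Om x -> `|Err x| <= bound x.
  move=> Omx; apply: (le_trans (ler_normD _ _)).
  apply: (@le_trans _ _ (\sum_(i < n) M * (d + (partial i (phi k) x - Du i x) ^+ 2 / d)
      + M * (d + (phi k x - u x) ^+ 2 / d))).
    apply: lerD; last by rewrite normrM ler_pM// GM.
    apply: (le_trans (ler_norm_sum _ _ _)); apply: ler_sum => i _.
    by rewrite normrM ler_pM// FM.
  rewrite -big_distrr /= big_split /= -mulr_suml sumr_const card_ord /bound /T.
  rewrite -natr1; set s := \sum_(i < n) _; set b := _ ^+ 2.
  rewrite -mulr_natl le_eqVlt; apply/orP; left; apply/eqP; ring.
rewrite J_eq normrN; apply: (le_trans (le_normr_Rintegral mOm LErr)).
apply: (@le_trans _ _ (\int[mu]_(x in Om) bound x)).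
  apply: le_Rintegral => //; exact: integrable_norm.
rewrite RintegralD//; last 2 first.
- exact: cbounded_L1 (cbounded_cst _).
- exact: L1Z.
rewrite Rintegral_cst// RintegralZl// -/m.
rewrite (_ : M * (n.+1%:R * m + 1) * d = M * n.+1%:R * d * m + M * d); last by ring.
rewrite lerD2l -mulrA ler_wpM2l//.
by rewrite mulrC ler_pdivrMr// -expr2 ltW.
Qed.

End integrable_functions.

(** * Integration by parts against a function with zero boundary values *)

Section truncation.
Context {R : realType}.

(** Its square, as a function of [t], is of class [C^1] and vanishes for
    [t >= - eps]; half of the derivative of the square is [trunc eps] again. *)
Definition trunc (eps t : R) : R := Num.min (t + eps) 0.

(** Taylor remainder of a function whose derivative is 2-Lipschitz. *)
Lemma trunc_sq_taylor eps s t :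
  `|trunc eps s ^+ 2 - trunc eps t ^+ 2 - 2 * trunc eps t * (s - t)| <= (s - t) ^+ 2.
Proof.
have -> : s - t = (s + eps) - (t + eps) by ring.
rewrite /trunc; move: (s + eps) (t + eps) => {s t} s t; rewrite ler_norml.
have s2 := sqr_ge0 s; have t2 := sqr_ge0 t; have st2 := sqr_ge0 (s - t).
have [hs|hs] := leP s 0; have [ht|ht] := leP t 0; apply/andP; split.
all: by [nra | have : s * t <= 0; nra].
Qed.

Lemma is_derive_trunc_sq eps (t : R) :
  is_derive t (1 : R) (fun s => trunc eps s ^+ 2) (2 * trunc eps t).
Proof.
have C : (fun h : R => h^-1 *: (((fun s => trunc eps s ^+ 2) \o shift t) (h *: 1)
    - trunc eps t ^+ 2)) @ 0^' --> 2 * trunc eps t.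
  apply/cvgrPdistC_le => e e0; near=> h.
  have h0 : h != 0 by near: h; exact: nbhs_dnbhs_neq.
  have he : `|h| < e by near: h; exact: dnbhs0_lt.
  have := trunc_sq_taylor eps (h + t) t; rewrite addrK => H.
  have nh0 : 0 < `|h| by rewrite normr_gt0.
  rewrite /= [h *: 1]mulr1 -(ler_pM2r nh0) -normrM.
  rewrite (_ : (_ - _) * h =
    trunc eps (h + t) ^+ 2 - trunc eps t ^+ 2 - 2 * trunc eps t * h); last first.
    by rewrite mulrBl; congr (_ - _); rewrite mulrC mulrA divff// mul1r.
  apply: (le_trans H); rewrite -(real_normK (num_real h)) expr2.
  by rewrite ler_pM2r// ltW.
apply: DeriveDef; first by apply/cvg_ex; eexists; exact: C.
by apply: cvg_lim => //; exact: C.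
Unshelve. all: by end_near. Qed.

Lemma continuous_trunc eps : continuous (trunc eps).
Proof.
move=> t; apply/cvgrPdist_le => e e0; near=> s.
apply: (@le_trans _ _ `|t - s|); last by near: s; exact: cvgr_dist_le.
rewrite /trunc (_ : t - s = (t + eps) - (s + eps)); last by ring.
move: (t + eps) (s + eps) => a b.
have := ler_norm (a - b); have := ler_norm (- (a - b)); rewrite normrN ler_norml.
by have [ha|ha] := leP a 0; have [hb|hb] := leP b 0; move=> h1 h2; apply/andP; split; lra.
Unshelve. all: by end_near. Qed.

Lemma trunc_norm_le eps t : 0 <= eps -> t <= 0 -> `|trunc eps t| <= `|t|.
Proof.
move=> e0 t0; rewrite (ler0_norm t0) /trunc ler_norml.
by have [h|h] := leP (t + eps) 0; apply/andP; split; lra.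
Qed.

Lemma trunc_diff eps t : 0 < eps ->
  0 <= trunc (2 * eps) t - trunc eps t <= eps.
Proof.
move=> e0; rewrite /trunc.
by have [h|h] := leP (t + eps) 0; have [h2|h2] := leP (t + 2 * eps) 0;
  apply/andP; split; lra.
Qed.

Lemma trunc_diff_eq eps t : 0 < eps -> 2 * eps <= - t ->
  trunc (2 * eps) t - trunc eps t = eps.
Proof. by move=> e0 h; rewrite /trunc !min_l; lra. Qed.

End truncation.

Section composition.
Context {R : realType} (n : nat).
Local Notation V := 'rV[R]_n.
Local Notation e i := (delta_mx ord0 i : V).
Implicit Types (Om : set V) (w : V -> R) (x v : V).

(** The restriction of [w] to a line reduces this to the chain rule in one
    variable. *)
Lemma is_derive_comp_dir (h : R -> R) (w : V -> R) x v (dh dw : R) :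
  is_derive (w x) (1 : R) h dh -> is_derive x v w dw ->
  is_derive x v (fun y => h (w y)) (dh * dw).
Proof.
move=> Dh Dw.
have g0 : w (0 *: v + x) = w x by rewrite scale0r add0r.
pose g (s : R) := w (s *: v + x).
have Eg (k : V -> R) : (fun t : R => t^-1 *: (((fun s : R => k (s *: v + x)) \o shift 0) (t *: 1)
    - k (0 *: v + x))) = (fun t : R => t^-1 *: ((k \o shift x) (t *: v) - k x)).
  by apply/funext => t /=; rewrite addr0 scale0r add0r [t *: 1]mulr1.
have Dg : is_derive (0 : R) (1 : R) g dw.
  by case: Dw => [dw1 <-]; apply: DeriveDef; rewrite /derivable /derive Eg.
have Dh' : is_derive (g 0) (1 : R) h dh by rewrite /g g0.
have [C <-] := is_derive1_comp Dh' Dg.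
apply: DeriveDef; first by move: C; rewrite /derivable (Eg (fun y => h (w y))).
by rewrite /derive (Eg (fun y => h (w y))).
Qed.

Lemma Ck1_comp Om (h dh : R -> R) w : open Om ->
  (forall t : R, is_derive t (1 : R) h (dh t)) -> continuous dh -> Ck 1 Om w ->
  Ck 1 Om (fun y => h (w y)) /\
  forall i x, Om x -> partial i (fun y => h (w y)) x = dh (w x) * partial i w x.
Proof.
move=> oOm Dh cdh Cw.
have D i x : Om x -> is_derive x (e i) (fun y => h (w y)) (dh (w x) * partial i w x).
  move=> Omx; apply: is_derive_comp_dir (Dh _) _.
  exact: derivableP (Ck_derivable i Cw Omx).
have ch : continuous h.
  by move=> t; apply/differentiable_continuous/derivable1_diffP; case: (Dh t).
have pE i x : Om x -> partial i (fun y => h (w y)) x = dh (w x) * partial i w x.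
  by move=> Omx; case: (D i x Omx).
split=> //; apply/CkSP; split=> [x Omx|i].
  split; last by move=> i; case: (D i x Omx).
  apply: (@continuous_comp _ _ _ w h); first exact: Ck_continuous Cw Omx.
  exact: ch.
apply: (@Ck_eq R n 0 Om (fun x => dh (w x) * partial i w x)) => //.
  by move=> x; rewrite inE => Omx; rewrite pE.
apply: (CkM oOm); last exact: Ck_partial.
apply/Ck0P => x Omx; apply: (@continuous_comp _ _ _ w dh).
  exact: Ck_continuous Cw Omx.
exact: cdh.
Qed.

End composition.

Section zero_boundary_values.
Context {R : realType} (n : nat).
Local Notation V := 'rV[R]_n.
Local Notation mu := (@lebesgue_rV R n).
Implicit Types (Om : set V) (w : V -> R) (x : V).

(** A boundary point in the closure of a sublevel set would have [w <= - eps],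
    against [w = 0]. *)
Lemma closure_sublevel_sub Om w (eps : R) : open Om -> bounded_set Om -> 0 < eps ->
  {within closure Om, continuous w} -> (forall x, bdry Om x -> w x = 0) ->
  let K := closure [set x | Om x /\ w x <= - eps] in compact K /\ K `<=` Om.
Proof.
move=> oOm bOm eps0 cw w0 K.
have KcOm : K `<=` closure Om by apply: closureS => x [].
split.
  apply: (subclosed_compact _ (compact_closure_bounded bOm)) => //.
  exact: closed_closure.
move=> x Kx; have clx := KcOm _ Kx.
have [//|bx] := bdryP oOm clx; exfalso.
have wx : w x = 0 by exact: w0.
have := cw; rewrite subspace_continuousP => /(_ x clx) cwx.
have : \forall y \near within (closure Om) (nbhs x), - eps < w y.
  have : - eps < w x by rewrite wx oppr_lt0.
  by move/cvgr_gt : cwx; exact.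
rewrite /within /= => /Kx[y [[Omy wy]]] /(_ (subset_closure Omy)).
by apply/negP; rewrite -leNgt.
Qed.

(** Integration by parts against [w] itself: [Z . grad w] integrates to 0 for
    a divergence-free [Z].  As [w] has no compact support it is replaced by
    [trunc eps w ^+ 2]; the difference quotient in [eps] of the resulting
    weights [trunc eps w] tends to 1 where [w < 0], and [grad w = 0] where
    [w = 0] because [w <= 0]. *)
Lemma integral_divfree_grad_eq0 Om w (Z : 'I_n -> V -> R) :
  open Om -> bounded_set Om -> Ck 1 Om w ->
  {within closure Om, continuous w} -> (forall x, bdry Om x -> w x = 0) ->
  (forall x, Om x -> w x <= 0) ->
  (forall i, Ck 1 Om (Z i)) ->
  (forall x, Om x -> \sum_(i < n) partial i (Z i) x = 0) ->
  cbounded Om w -> cbounded Om (fun x => \sum_(i < n) Z i x * partial i w x) ->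
  \int[mu]_(x in Om) (\sum_(i < n) Z i x * partial i w x) = 0.
Proof.
move=> oOm bOm Cw cw w0 wle CZ divZ bw cP.
set P := fun x => _ in cP.
have mOm : measurable Om by exact: open_measurable_rV.
have fOm : (mu Om < +oo)%E by exact: bounded_set_finite.
have IP : mu.-integrable Om (EFin \o P) by exact: cbounded_L1.
have ctr eps : 0 < eps -> cbounded Om (fun x => trunc eps (w x)).
  move=> e0; split=> [x Omx|].
    apply: (@continuous_comp _ _ _ w (trunc eps)); last exact: continuous_trunc.
    exact: Ck_continuous Cw Omx.
  have [_ [B HB]] := bw; exists B => x Omx; apply: le_trans (HB x Omx).
  by apply: trunc_norm_le; [exact: ltW|exact: wle].
have P_trunc eps : 0 < eps -> \int[mu]_(x in Om) (P x * trunc eps (w x)) = 0.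
  move=> eps0.
  have [cK KOm] := closure_sublevel_sub oOm bOm eps0 cw w0.
  set K := closure _ in cK KOm.
  have c2 : continuous (fun t : R => 2 * trunc eps t).
    move=> t; apply: cvgM; first exact: cvg_cst.
    exact: continuous_trunc.
  have [Cf pf] := Ck1_comp oOm (is_derive_trunc_sq eps) c2 Cw.
  have f0 x : Om x -> ~ K x -> trunc eps (w x) ^+ 2 = 0.
    move=> Omx nKx; rewrite /trunc min_r ?expr0n//.
    rewrite -lerBlDr sub0r leNgt; apply/negP => wx; apply: nKx.
    by apply: subset_closure; split => //; exact: ltW.
  have := @integral_flux_eq0 R n Om oOm fOm K Z _ cK KOm CZ Cf f0.
  rewrite (_ : Rintegral _ _ _ = \int[mu]_(x in Om) (2 * (P x * trunc eps (w x)))).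
    rewrite RintegralZl//; last exact: cbounded_L1 (cboundedM cP (ctr eps eps0)).
    by move/eqP; rewrite mulf_eq0 pnatr_eq0 /= => /eqP.
  apply: eq_Rintegral => x; rewrite inE => Omx.
  rewrite divZ// mul0r addr0 /P mulr_suml mulr_sumr; apply: eq_bigr => i _.
  by rewrite pf//; ring.
pose ek k : R := k.+1%:R^-1.
have ek0 k : 0 < ek k by rewrite invr_gt0.
pose r k x : R := (trunc (2 * ek k) (w x) - trunc (ek k) (w x)) * k.+1%:R.
have r01 k x : 0 <= r k x <= 1.
  have /andP[h0 h1] := trunc_diff (w x) (ek0 k).
  rewrite mulr_ge0//= (le_trans (ler_wpM2r _ h1))//.
  by rewrite mulVf// pnatr_eq0.
have cr k : cbounded Om (r k).
  apply: cboundedM; last exact: cbounded_cst.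
  apply: cboundedD; first by apply: ctr; rewrite mulr_gt0.
  have := cboundedM (@cbounded_cst R n Om (-1)) (ctr _ (ek0 k)).
  by apply: cbounded_eq => // x _; rewrite mulN1r.
have IPr k : mu.-integrable Om (EFin \o (fun x => P x * r k x)).
  by apply: cbounded_L1 => //; exact: cboundedM.
have Pr0 k : \int[mu]_(x in Om) (P x * r k x) = 0.
  have e20 : 0 < 2 * ek k by rewrite mulr_gt0.
  have I1 := cbounded_L1 oOm fOm (cboundedM cP (ctr _ e20)).
  have I2 := cbounded_L1 oOm fOm (cboundedM cP (ctr _ (ek0 k))).
  rewrite (_ : Rintegral _ _ _ = \int[mu]_(x in Om)
    (k.+1%:R * (P x * trunc (2 * ek k) (w x) - P x * trunc (ek k) (w x)))).
    rewrite RintegralZl//; last exact: (integrableB mOm I1 I2).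
    by rewrite RintegralB// !P_trunc// subrr mulr0.
  by apply: eq_Rintegral => x _; rewrite /r; ring.
have Prx x : Om x -> (P x * r k x)%:E @[k --> \oo] --> (P x)%:E.
  move=> Omx; apply: cvg_near_cst.
  have [wx0|wx0] := eqVneq (w x) 0.
    have -> : P x = 0.
      rewrite /P big1// => i _; rewrite (@partial_eq0_at_max R n Om w x i) ?mulr0//.
      by move=> y Omy; rewrite wx0; exact: wle.
    by near=> k; rewrite mul0r.
  have wlt : 0 < - w x / 2 by rewrite divr_gt0// oppr_gt0 lt_neqAle wx0 wle.
  have := near_infty_natSinv_lt (PosNum wlt) => /= nk.
  near=> k; have hk : ek k < - w x / 2 by near: k.
  rewrite /r trunc_diff_eq//; last by lra.
  by rewrite mulVf ?mulr1// pnatr_eq0.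
have mPr k : measurable_fun Om (fun x => (P x * r k x)%:E).
  exact: measurable_int (IPr k).
have mP : measurable_fun Om (EFin \o P) by exact: measurable_int IP.
have dom : {ae mu, forall x k, Om x -> (`|(P x * r k x)%:E| <= (abse \o (EFin \o P)) x)%E}.
  apply: aeW => x k _ /=; rewrite lee_fin normrM ler_piMr//.
  by have /andP[r0 r1] := r01 k x; rewrite ger0_norm.
have IaP : mu.-integrable Om (abse \o (EFin \o P)) by exact: integrable_abse.
have [_ _] := dominated_convergence mOm mPr mP (aeW _ Prx) IaP dom.
rewrite (_ : (fun k => _) = (fun=> 0%E)); last first.
  apply/funext => k; rewrite /= -[LHS]fineK; last exact: integrable_fin_num (IPr k).
  by have := Pr0 k; rewrite /Rintegral => ->.
move=> cv; rewrite /Rintegral.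
have -> : (\int[mu]_(x in Om) (P x)%:E = 0)%E.
  by apply: (cvg_unique _ cv); [exact: ereal_hausdorff|exact: cvg_cst].
by [].
Unshelve. all: by end_near. Qed.

End zero_boundary_values.

(** * The inequality *)

Section bounded_derivatives.
Context {R : realType} (n : nat).
Local Notation V := 'rV[R]_n.
Implicit Types (Om : set V) (w : V -> R).

Lemma Ckh_closure_cbounded k (a : R) Om w (s : seq 'I_n) : bounded_set Om ->
  Ckh_closure k a Om w -> (size s <= k)%N -> cbounded Om (iter_partial s w).
Proof.
move=> bOm [Cw _ Hext _] sk; split=> [x Omx|].
  by have [] := Cw s x sk Omx.
have [g cg gE] := Hext s sk.
have [cl0|/set0P cl0] := eqVneq (closure Om) set0.
  exists 0 => x /subset_closure; rewrite cl0; by [].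
have cng : {within closure Om, continuous (fun x => `|g x|)}.
  by move=> x; apply: continuous_comp (cg x) _; exact: norm_continuous.
have [c _ Hc] := EVT_max_rV cl0 (compact_closure_bounded bOm) cng.
exists `|g c| => x Omx; rewrite -gE//; apply: Hc.
by rewrite inE; exact: subset_closure.
Qed.

Lemma cbounded_flux Om w (c : R) i : bounded_set Om ->
  (forall i, cbounded Om (partial i w)) ->
  (forall i j, cbounded Om (fun x => hessian w x i j)) ->
  cbounded Om (flux w c i).
Proof.
move=> bOm cp ch; apply: cbounded_sum => j; apply: cboundedM; last exact: cp.
apply: cboundedD; last exact: cbounded_cst.
under eq_fun do rewrite expand_cofactor.
apply: cbounded_sum => s; apply: cboundedM; first exact: cbounded_cst.
by apply: cbounded_prod => l; exact: ch.
Qed.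

End bounded_derivatives.

(** [cofactor_mx W - 1] is the matrix of the linearized operator; its product with
    [grad w] is [flux w 1]. *)
Lemma bil_flux (R : realType) n (w : 'rV[R]_n -> R) x (v : 'I_n -> R) :
  bil (cofactor_mx (hessian w x) - 1%:M) (\row_i v i) (\row_i partial i w x) =
  \sum_(i < n) flux w 1 i x * v i.
Proof.
rewrite bilE; apply: eq_bigr => i _; rewrite /flux mulr_suml.
by apply: eq_bigr => j _; rewrite !mxE; ring.
Qed.

Lemma bil_cofactor_sub1 (R : realType) n (W : 'M[R]_n) (v : 'I_n -> R) :
  bil (cofactor_mx W - 1%:M) (\row_i v i) (\row_i v i) =
  \sum_(i < n) \sum_(j < n) v i * v j *
     partial_entry (fun M : 'M[R]_n => \det M) i j W - \sum_(i < n) v i ^+ 2.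
Proof.
rewrite bilB; congr (_ - _).
  rewrite bilE; apply: eq_bigr => i _; apply: eq_bigr => j _.
  by rewrite partial_entry_det !mxE.
by rewrite bil1; apply: eq_bigr => i _; rewrite mxE.
Qed.

Theorem theorem1p2 (R : realType) (n : nat) (Om : set 'rV[R]_n) (a : R)
    (w : 'rV[R]_n -> R)
    (n2 : (2 <= n)%N) (a01 : 0 < a < 1)
    (Om_domain : is_domain Om) (Om_bounded : bounded_set Om)
    (Om_bdry : Ckh_boundary 4 a Om)
    (Om_curv : positive_gauss_curvature 4 a Om)
    (w_reg : Ckh_closure 4 a Om w)
    (w_eq : forall x, Om x -> \det (hessian w x) - laplacian w x = 0)
    (w_bdry : forall x, bdry Om x -> w x = 0)
    (w_nontrivial : exists2 x, Om x & w x != 0)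
    (w_le0 : forall x, Om x -> w x <= 0)
    (u : 'rV[R]_n -> R) (Du : 'I_n -> 'rV[R]_n -> R)
    (u_W12_0 : W12_0 Om u Du) :
  (n%:R - 1) / (\int[lebesgue_rV n]_(x in Om) (\sum_i partial i w x ^+ 2))
    * (\int[lebesgue_rV n]_(x in Om) (u x * laplacian w x)) ^+ 2
  + \int[lebesgue_rV n]_(x in Om) (\sum_i Du i x ^+ 2)
  <= \int[lebesgue_rV n]_(x in Om)
       (\sum_i \sum_j Du i x * Du j x
          * partial_entry (fun W : 'M[R]_n => \det W) i j (hessian w x)).
Proof.
have [oOm conOm _] := Om_domain.
have [Cw4 cw _ _] := w_reg.
have Cw k : (k <= 4)%N -> Ck k Om w by move=> k4; exact: Ck_le k4 Cw4.
have mOm : measurable Om by exact: open_measurable_rV.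
have fOm : (lebesgue_rV n Om < +oo)%E by exact: bounded_set_finite.
have w_det x : Om x -> \det (hessian w x) = \tr (hessian w x).
  by move=> Omx; apply/eqP; rewrite -subr_eq0 -laplacian_tr w_eq.
have Hpsd := hessian_psd_on n2 oOm conOm Om_bounded (Cw 2 isT) cw w_det w_bdry
  w_le0 w_nontrivial.
have Epsd x : Om x -> psd (cofactor_mx (hessian w x) - 1%:M).
  by move=> Omx; have [px trx] := Hpsd x Omx; exact: psd_cofactor_ge1 (w_det x Omx) trx.
have bd s : (size s <= 4)%N -> cbounded Om (iter_partial s w).
  exact: Ckh_closure_cbounded Om_bounded w_reg.
have cb_w : cbounded Om w := bd [::] isT.
have cb_p i : cbounded Om (partial i w) := bd [:: i] isT.
have cb_h i j : cbounded Om (fun x => hessian w x i j).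
  by rewrite hessian_entryE; exact: (bd [:: i; j] isT).
have cb_lap : cbounded Om (laplacian w).
  by apply: cbounded_sum => i; exact: (bd [:: i; i] isT).
have cb_fl c i : cbounded Om (flux w c i) by exact: cbounded_flux.
have [[Lu HDu] _] := u_W12_0.
have LDu i : square_integrable Om (Du i) by case: (HDu i).
have Lcb f : cbounded Om f -> square_integrable Om f by exact: cbounded_L2.
(* The linearized operator has divergence form and maps [w] to (n-1) Lap w. *)
have div_lin x : Om x ->
    \sum_i partial i (flux w 1 i) x = (n%:R - 1) * laplacian w x.
  move=> Omx; rewrite (div_flux 1 oOm (Cw 3 isT) Omx) w_det// laplacian_tr.
  by ring.
have div_n x : Om x -> \sum_i partial i (flux w n%:R i) x = 0.
  move=> Omx; rewrite (div_flux n%:R oOm (Cw 3 isT) Omx) w_det// laplacian_tr.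
  by rewrite subrr.
set D := \int[_]_(x in Om) (\sum_i partial i w x ^+ 2).
set I := \int[_]_(x in Om) (u x * laplacian w x).
set N := \int[_]_(x in Om) (\sum_i Du i x ^+ 2).
set Q := \int[_]_(x in Om) _.
pose b x := \sum_(i < n) flux w 1 i x * Du i x.
pose c x := \sum_(i < n) flux w 1 i x * partial i w x.
pose q x := \sum_i \sum_j Du i x * Du j x
          * partial_entry (fun W : 'M[R]_n => \det W) i j (hessian w x).
have Ib : (lebesgue_rV n).-integrable Om (EFin \o b).
  by apply: L1_sum => // i; apply: L2M => //; exact: Lcb.
have Ic : (lebesgue_rV n).-integrable Om (EFin \o c).
  by apply: L1_sum => // i; apply: L2M => //; exact: Lcb.
have IN : (lebesgue_rV n).-integrable Om (EFin \o (fun x => \sum_(i < n) Du i x ^+ 2)).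
  by apply: L1_sum => // i; exact: L2_L1.
have ID : (lebesgue_rV n).-integrable Om (EFin \o (fun x => \sum_(i < n) partial i w x ^+ 2)).
  by apply: L1_sum => // i; apply: L2_L1 => //; exact: Lcb.
have II : (lebesgue_rV n).-integrable Om (EFin \o (fun x => u x * laplacian w x)).
  by apply: L2M => //; exact: Lcb.
have Iq : (lebesgue_rV n).-integrable Om (EFin \o q).
  apply: L1_sum => // i; apply: L1_sum => // j.
  have cbc : cbounded Om (fun x => cofactor (hessian w x) i j).
    under eq_fun do rewrite expand_cofactor.
    apply: cbounded_sum => s; apply: cboundedM; first exact: cbounded_cst.
    by apply: cbounded_prod => l; exact: cb_h.
  have := L2M oOm (LDu i) (L2_cboundedM oOm cbc (LDu j)).
  congr (is_true (_.-integrable _ _)); apply/funext => x /=.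
  by rewrite partial_entry_det; congr EFin; ring.
have b_eq : \int[lebesgue_rV n]_(x in Om) b x = - ((n%:R - 1) * I).
  have cbG : cbounded Om (fun x => (n%:R - 1) * laplacian w x).
    by apply: cboundedM => //; exact: cbounded_cst.
  have := W12_0_functional_eq0 oOm fOm (cb_fl 1) cbG _ u_W12_0.
  rewrite RintegralD//; last first.
    by apply: L2M => //; exact: Lcb.
  have -> : \int[lebesgue_rV n]_(x in Om) ((n%:R - 1) * laplacian w x * u x) =
      (n%:R - 1) * I.
    rewrite -RintegralZl//; apply: eq_Rintegral => x _.
    by rewrite -mulrA (mulrC (u x)).
  move=> H; apply/eqP; rewrite -addr_eq0; apply/eqP; apply: H => phi [Cphi cK sOm].
  have Cphi1 : Ck 1 Om phi by move=> s x s1 _; exact: Cphi.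
  rewrite -[RHS](@integral_flux_eq0 R n Om oOm fOm _ (flux w 1) phi cK sOm).
  - by apply: eq_Rintegral => x; rewrite inE => Omx; rewrite div_lin.
  - by move=> i; apply: Ck_flux => //; exact: Cw.
  - exact: Cphi1.
  - move=> x _ nKx; apply/eqP/negPn/negP => px; apply: nKx.
    exact: subset_closure.
have c_eq : \int[lebesgue_rV n]_(x in Om) c x = (n%:R - 1) * D.
  have := @integral_divfree_grad_eq0 R n Om w (flux w n%:R) oOm Om_bounded
    (Cw 1 isT) cw w_bdry w_le0.
  move=> /(_ _ div_n cb_w) H; rewrite -[RHS]addr0 -[X in _ + X]H; last 2 first.
  - by move=> i; apply: Ck_flux => //; exact: Cw.
  - by apply: cbounded_sum => i; exact: cboundedM.
  rewrite -RintegralZl// -RintegralD//; last 2 first.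
  - exact: L1Z.
  - by apply: L1_sum => // i; apply: L2M => //; exact: Lcb.
  apply: eq_Rintegral => x _; rewrite /c mulr_sumr -big_split /=.
  apply: eq_bigr => i _.
  suff -> : flux w 1 i x = flux w n%:R i x + (n%:R - 1) * partial i w x by ring.
  rewrite /flux [X in _ = _ + X](_ : _ =
    \sum_j (n%:R - 1) * (i == j)%:R * partial j w x).
    by rewrite -big_split; apply: eq_bigr => j _ /=; ring.
  rewrite (bigD1 i)//= eqxx mulr1 big1 ?addr0// => j ji.
  by rewrite eq_sym (negbTE ji) mulr0 mul0r.
(* The integral of the form of [cofactor - 1] at [Du + t Dw], expanded in [t];
   its value at [Du] is [Q - N]. *)
have Qt t : 0 <= Q - N + 2 * t * (- ((n%:R - 1) * I)) + t ^+ 2 * ((n%:R - 1) * D).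
  rewrite -b_eq -c_eq.
  have -> : Q - N + 2 * t * (\int[lebesgue_rV n]_(x in Om) b x)
      + t ^+ 2 * (\int[lebesgue_rV n]_(x in Om) c x) =
    \int[lebesgue_rV n]_(x in Om)
      ((q x - \sum_(i < n) Du i x ^+ 2) + 2 * t * b x + t ^+ 2 * c x).
    have I1 := integrableB mOm Iq IN.
    have I2 := L1Z oOm (2 * t) Ib.
    have I3 := L1Z oOm (t ^+ 2) Ic.
    rewrite RintegralD//; last exact: L1D.
    by rewrite RintegralD// RintegralB// !RintegralZl.
  apply: Rintegral_ge0 => x Omx.
  have := (Epsd x Omx).2 (\row_i Du i x + t *: \row_i partial i w x).
  rewrite bilDZ; last exact: (Epsd x Omx).1.
  by rewrite bil_cofactor_sub1 !bil_flux.
(* The polynomial in [t] is smallest at [I / D]; this value is [0] if [D = 0]. *)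
have := Qt (I / D); have [->|D0] := eqVneq D 0.
  by rewrite !(invr0, mulr0, mul0r, addr0, add0r) subr_ge0.
rewrite (_ : _ + _ + _ = Q - ((n%:R - 1) / D * I ^+ 2 + N)); last by field.
by rewrite subr_ge0.
Qed.
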